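(* Let $X$ be a Banach space with a long unconditional Schauder basis $\{e_\gamma\}_{\gamma\in\Gamma}$, and let $Y:=\operatorname{span}\{e_\gamma\}_{\gamma\in\Gamma}$ be the (algebraic) linear span of this basis. Then $Y$ admits an equivalent $C^\infty$-smooth norm.
   Context: All spaces are real. A set $\{e_\gamma\}_{\gamma\in\Gamma}$ (with $\Gamma$ an arbitrary index set) in a Banach space $X$ is a (long) unconditional Schauder basis of $X$ if for every $x\in X$ there is a unique family of real numbers $\{a_\gamma\}_{\gamma\in\Gamma}$ such that $x=\sum_{\gamma\in\Gamma}a_\gamma e_\gamma$ in the following sense: for every $\varepsilon>0$ there is a finite set $F\subseteq\Gamma$ such that $\|x-\sum_{\gamma\in G}a_\gamma e_\gamma\|<\varepsilon$ for every finite $G\subseteq\Gamma$ with $F\subseteq G$. The subspace $Y$ carries the restriction of the norm of $X$, and ''equivalent'' refers to this restricted norm. A norm on a normed space $Y$ is $C^\infty$-smooth if, for every $k\in\mathbb{N}$, its $k$-th Fréchet derivative exists and is continuous at every point of $Y\setminus\{0\}$. *)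

(* Defs.v *)
(* MathComp-Analysis; the scalars are the reals, R : realType *)
From HB Require Import structures.
From mathcomp Require Import all_boot all_order all_algebra finmap.
From mathcomp Require Import all_classical all_reals all_analysis.
From mathcomp Require summability.

Set Implicit Arguments.
Unset Strict Implicit.
Unset Printing Implicit Defensive.

Import Order.TTheory GRing.Theory Num.Theory.
Import numFieldNormedType.Exports.

Local Open Scope classical_set_scope.
Local Open Scope ring_scope.

Section ContinuousLinear.
Context {R : realType} (V W : normedModType R).

Definition clin_pred : {pred V -> W} :=
  fun f => `[< (forall a u v, f (a *: u + v) = a *: f u + f v) /\
              continuous f >].

(* The space L(V, W) of continuous linear maps, with the operator norm. *)
Record clin := CLin { clin_fun :> V -> W; _ : clin_fun \in clin_pred }.

HB.instance Definition _ := [isSub for clin_fun].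
HB.instance Definition _ := [Choice of clin by <:].

Lemma clin_submod : submod_closed clin_pred.
Proof.
split.
  by apply/asboolP; split=> [a u v|x]; [rewrite scaler0 addr0|exact: cvg_cst].
move=> a f g /asboolP[fl fc] /asboolP[gl gc]; apply/asboolP; split.
  move=> b u v; rewrite !fctE fl gl !scalerDr !scalerA [a * b]mulrC.
  by rewrite addrACA.
by move=> x; apply: cvgD; [apply: cvgZr; exact: fc|exact: gc].
Qed.

HB.instance Definition _ :=
  GRing.isSubmodClosed.Build R (V -> W) clin_pred clin_submod.
HB.instance Definition _ := [SubChoice_isSubLmodule of clin by <:].

Lemma clin_linear (f : clin) a u v : f (a *: u + v) = a *: f u + f v.
Proof. by case: f => f /= /asboolP[]. Qed.

Lemma clin_continuous (f : clin) : continuous f.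
Proof. by case: f => f /= /asboolP[]. Qed.

HB.instance Definition _ (f : clin) :=
  GRing.isLinear.Build R V W *:%R (clin_fun f) (clin_linear f).

Lemma clinE (a : R) (f g : clin) v : (a *: f + g) v = a *: f v + g v.
Proof. by []. Qed.

Definition opnorm (f : clin) : R := sup [set `|f v| | v in [set v | `|v| <= 1]].

Lemma opnorm_has_sup (f : clin) :
  has_sup [set `|f v| | v in [set v | `|v| <= 1]].
Proof.
split; first by exists `|f 0|; exists 0 => //=; rewrite normr0.
have /linear_bounded_continuous/linear_boundedP/pinfty_ex_gt0[M M0 fM] :=
  @clin_continuous f.
exists M => _ [v /= v1 <-]; apply: le_trans (fM v) _.
by rewrite ler_piMr// ltW.
Qed.

Lemma le_opnorm (f : clin) v : `|f v| <= opnorm f * `|v|.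
Proof.
have [->|v0] := eqVneq v 0; first by rewrite linear0 !normr0 mulr0.
have nv0 : 0 < `|v| by rewrite normr_gt0.
rewrite -ler_pdivrMr//.
have -> : `|f v| / `|v| = `|f (`|v|^-1 *: v)|.
  by rewrite linearZ/= normrZ ger0_norm ?invr_ge0// mulrC.
apply: ub_le_sup; first by case: (opnorm_has_sup f).
by exists (`|v|^-1 *: v) => //=; rewrite normrZ ger0_norm ?invr_ge0// mulVf ?gt_eqF.
Qed.

Lemma opnorm_le (f : clin) (M : R) :
  (forall v, `|v| <= 1 -> `|f v| <= M) -> opnorm f <= M.
Proof.
move=> fM; apply: ge_sup; first by case: (opnorm_has_sup f).
by move=> _ [v v1 <-]; exact: fM.
Qed.

Lemma opnorm_ge0 (f : clin) : 0 <= opnorm f.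
Proof.
apply: (@le_trans _ _ `|f 0|) => //; apply: ub_le_sup.
  by case: (opnorm_has_sup f).
by exists 0 => //=; rewrite normr0.
Qed.

Lemma opnormD (f g : clin) : opnorm (f + g) <= opnorm f + opnorm g.
Proof.
apply: opnorm_le => v v1; have -> : (f + g) v = f v + g v by [].
apply: le_trans (ler_normD _ _) _; apply: lerD.
  by apply: le_trans (le_opnorm f v) _; rewrite ler_piMr ?opnorm_ge0.
by apply: le_trans (le_opnorm g v) _; rewrite ler_piMr ?opnorm_ge0.
Qed.

Lemma opnormZ_le (a : R) (f : clin) : opnorm (a *: f) <= `|a| * opnorm f.
Proof.
apply: opnorm_le => v v1; have -> : (a *: f) v = a *: f v by [].
rewrite normrZ ler_wpM2l//.
by apply: le_trans (le_opnorm f v) _; rewrite ler_piMr ?opnorm_ge0.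
Qed.

Lemma opnormZ (a : R) (f : clin) : opnorm (a *: f) = `|a| * opnorm f.
Proof.
apply/eqP; rewrite eq_le opnormZ_le /=.
have [->|a0] := eqVneq a 0; first by rewrite normr0 mul0r opnorm_ge0.
have := opnormZ_le a^-1 (a *: f).
rewrite scalerA mulVf// scale1r normrV ?unitfE// -ler_pdivrMl ?invr_gt0 ?normr_gt0//.
by rewrite invrK.
Qed.

Lemma opnorm0_eq0 (f : clin) : opnorm f = 0 -> f = 0.
Proof.
move=> f0; apply/val_inj/funext => v /=; apply/eqP; rewrite -normr_le0.
by apply: le_trans (le_opnorm f v) _; rewrite f0 mul0r.
Qed.

HB.instance Definition _ :=
  Lmodule_isNormed.Build R clin opnormD opnormZ opnorm0_eq0.

Lemma clin_normE (f : clin) : `|f| = opnorm f.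
Proof. by []. Qed.

(* The derivative x |-> Df(x) as a map V -> L(V, W); the value is
   meaningful only at the points where f is differentiable. *)
Definition fderive (f : V -> W) (x : V) : clin := insubd 0 ('d f x : V -> W).

Lemma fderiveE (f : V -> W) (x : V) :
  differentiable f x -> fderive f x = 'd f x :> (V -> W).
Proof.
move=> df; rewrite /fderive; apply: insubdK; apply/asboolP; split.
  by move=> a u v; rewrite linearP.
exact: diff_continuous.
Qed.

End ContinuousLinear.

(* f has Frechet derivatives up to order k on the open set U, the k-th of
   which (with values in L(V, L(V, ... L(V, W)))) is continuous on U. *)
Fixpoint Ck_on {R : realType} {V : normedModType R} (U : set V) (k : nat)
    {W : normedModType R} (f : V -> W) {struct k} : Prop :=
  if k is k'.+1 then
    (forall x, U x -> differentiable f x) /\ Ck_on U k' (fderive f)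
  else forall x, U x -> {for x, continuous f}.

Section Span.
Context {R : realType} {X : normedModType R} {Gamma : choiceType}.
Variable e : Gamma -> X.

Definition lspan : {pred X} :=
  fun x => `[< exists (F : {fset Gamma}) (a : Gamma -> R),
                 x = \sum_(g <- F) a g *: e g >].

Record span_of := SpanOf { span_val :> X; _ : span_val \in lspan }.

HB.instance Definition _ := [isSub for span_val].
HB.instance Definition _ := [Choice of span_of by <:].

Lemma lspan_submod : submod_closed lspan.
Proof.
split.
  by apply/asboolP; exists fset0, (fun=> 0); rewrite big_seq_fset0.
move=> c _ _ /asboolP[F [a ->]] /asboolP[G [b ->]]; apply/asboolP.
exists (F `|` G)%fset, (fun g => c * (if g \in F then a g else 0) +
                            (if g \in G then b g else 0)).
under [RHS]eq_bigr do rewrite scalerDl -scalerA.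
rewrite big_split/= -scaler_sumr; congr (_ *: _ + _).
  rewrite -(big_fset_incl _ (fsubsetUl F G)).
    by rewrite big_seq [RHS]big_seq; apply: eq_bigr => g ->.
  by move=> g _ /negbTE ->; rewrite scale0r.
rewrite -(big_fset_incl _ (fsubsetUr F G)).
  by rewrite big_seq [RHS]big_seq; apply: eq_bigr => g ->.
by move=> g _ /negbTE ->; rewrite scale0r.
Qed.

HB.instance Definition _ :=
  GRing.isSubmodClosed.Build R X lspan lspan_submod.
HB.instance Definition _ := [SubChoice_isSubLmodule of span_of by <:].

Let span_norm (y : span_of) : R := `|val y|.

Let span_normD y z : span_norm (y + z) <= span_norm y + span_norm z.
Proof. exact: ler_normD. Qed.

Let span_normZ (c : R) y : span_norm (c *: y) = `|c| * span_norm y.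
Proof. exact: normrZ. Qed.

Let span_norm0_eq0 y : span_norm y = 0 -> y = 0.
Proof. by move=> /normr0_eq0 y0; exact: val_inj. Qed.

HB.instance Definition _ :=
  Lmodule_isNormed.Build R span_of span_normD span_normZ span_norm0_eq0.

Lemma span_normE (y : span_of) : `|y| = `|span_val y|.
Proof. by []. Qed.

(* The sums converge along the net of finite subsets of Gamma. *)
Definition unconditional_basis : Prop :=
  forall x : X, exists! a : Gamma -> R,
    summability.partial_sum (fun g => a g *: e g) @ summability.totally --> x.

Lemma cvg_partial_sumP (a : Gamma -> R) (x : X) :
  summability.partial_sum (fun g => a g *: e g) @ summability.totally --> x <->
  forall eps : R, 0 < eps -> exists F : {fset Gamma}, forall G : {fset Gamma},
    (F `<=` G)%fset -> `|x - \sum_(g <- G) a g *: e g| < eps.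
Proof.
have tF := @summability.totally_filter Gamma.
have psE (G : {fset Gamma}) :
    summability.partial_sum (fun g => a g *: e g) G = \sum_(g <- G) a g *: e g.
  by rewrite /summability.partial_sum big_seq_fsetE.
split=> [/cvgrPdist_lt cx eps /cx[F _ FG]|cx].
  by exists F => G FsG; rewrite -psE; exact: FG.
apply/cvgrPdist_lt => eps /cx[F FG]; exists F => // G /= FsG.
by rewrite psE; exact: FG.
Qed.

End Span.

Section Norms.
Context {R : realType} {Y : normedModType R}.

Definition is_norm (N : Y -> R) : Prop :=
  [/\ forall y z, N (y + z) <= N y + N z,
      forall (c : R) y, N (c *: y) = `|c| * N y &
      forall y, N y = 0 -> y = 0].

Definition equivalent_to_norm (N : Y -> R) : Prop :=
  exists c C : R, [/\ 0 < c, 0 < C & forall y, c * `|y| <= N y <= C * `|y|].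

(* Differentiability is with respect to the norm carried by Y, not N. *)
Definition smooth_norm (N : Y -> R) : Prop :=
  forall k, Ck_on [set y : Y | y != 0] k (N : Y -> R^o).

End Norms.

(* Main.v *)
From HB Require Import structures.
Require Import Defs.
From mathcomp Require Import all_boot all_order all_algebra finmap.
From mathcomp Require Import all_classical all_reals all_analysis.
From mathcomp Require Import lra ring.
From mathcomp Require summability.

(* Zabreiko's lemma bounds the coordinate projections uniformly, so on the span
   the norm is, up to constants, the supremum of the finitely supported
   functionals [g] whose [i]-th coefficient lies on the grid [+- |e i| / n] and
   for which [sum_i |g i * coef y i|] is dominated by the norm of [y]. This
   family is stable under restriction of the support. Multiply [g] by a weight
   strictly decreasing in the size of its support: near a vector [x] supported
   on [S], deleting from [g] the coordinates outside [S], and those with a tiny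
   coefficient, hardly changes the value but increases the weight, so only
   finitely many functionals compete for the supremum near [x].

   With [psi t = t exp(-1/t)] for [t > 0] and [0] otherwise ([flat 0] below),
   which is convex and smooth, the norm is the gauge [N] of the set
   [sum_g B_g psi (d_g y - 1) <= 1], where [d_g] is the weighted functional and
   the [B_g] are so large that the competition argument also applies to this
   sum. Near [x] the sum is finite and [sum_g B_g psi (d_g y / N y - 1) = 1].
   Implicit differentiation expresses the derivative of [N] through [N] itself,
   fixed functionals and derivatives of [psi]; the algebra of functions
   generated by these is closed under differentiation, which gives all
   derivatives at once. *)

Set Implicit Arguments.
Unset Strict Implicit.
Unset Printing Implicit Defensive.

Import Order.TTheory GRing.Theory Num.Theory.
Import numFieldNormedType.Exports.

Local Open Scope classical_set_scope.
Local Open Scope ring_scope.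

(** * Differentials *)

Section Differentials.
Context {R : realType} {V W : normedModType R}.
Implicit Types (f g : V -> W) (L : clin V W).

Lemma is_diff_le f (df : V -> W) x : is_diff x f df ->
  forall eps : R, 0 < eps ->
    \forall y \near x, `|f y - f x - df (y - x)| <= eps * `|y - x|.
Proof.
move=> [fx fxE] eps eps0.
have /eqaddoP/(_ eps eps0) H := diff_locally fx.
rewrite (near_shift 0 x) /= subr0.
apply: filterS H => h /=; rewrite !fctE fxE addrK.
by rewrite opprD addrA.
Qed.

Lemma is_diff_clinP f x L : is_diff x f L <->
  forall eps : R, 0 < eps ->
    \forall y \near x, `|f y - f x - L (y - x)| <= eps * `|y - x|.
Proof.
split=> [|fL]; first exact: is_diff_le.
have H : f \o shift x = cst (f x) + L +o_ (0:V) id.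
  apply/eqaddoP => eps eps0.
  have := fL _ eps0; rewrite (near_shift 0 x) /= subr0.
  apply: filterS => h /=; rewrite !fctE addrK.
  by rewrite opprD addrA.
have dE : 'd f x = L :> (V -> W) by apply: diff_unique => //;
  exact: clin_continuous.
split => //; apply/diff_locallyP; rewrite dE; split => //;
  exact: clin_continuous.
Qed.

Lemma is_diff_near f g x L :
  (\forall y \near x, f y = g y) -> is_diff x f L -> is_diff x g L.
Proof.
move=> fg /is_diff_clinP fL; apply/is_diff_clinP => eps /fL.
have -> : g x = f x by rewrite (nbhs_singleton fg).
by apply: filterS2 fg => y ->.
Qed.

Lemma is_diff_fderive f x : differentiable f x -> is_diff x f (fderive f x).
Proof. by move=> df; split => //; rewrite fderiveE. Qed.

Lemma fderive_is_diff f x L : is_diff x f L -> fderive f x = L.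
Proof.
by move=> [df dE]; apply/val_inj; rewrite /= fderiveE.
Qed.
End Differentials.

Section CkOn.
Context {R : realType} {V : normedModType R}.

(** Openness of [U] turns agreement on [U] into agreement near each of its points, so the
    derivatives agree on [U] too and the induction continues. *)
Lemma Ck_on_eq (U : set V) k (W : normedModType R) (f g : V -> W) :
  open U -> (forall y, U y -> f y = g y) -> Ck_on U k f -> Ck_on U k g.
Proof.
move=> oU; elim: k W f g => [|k IH] W f g fg /=.
  move=> fc x Ux; have := fc x Ux; rewrite /prop_for /continuous_at -(fg x Ux)
    => fx.
  apply: cvg_trans fx; apply: near_eq_cvg.
  by near=> y; apply/fg; near: y; exact: open_nbhs_nbhs.
have fgn x : U x -> \forall y \near x, f y = g y.
  by move=> Ux; near=> y; apply/fg; near: y; exact: open_nbhs_nbhs.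
have gd x : U x -> differentiable f x -> is_diff x g (fderive f x).
  by move=> Ux df; apply: is_diff_near (is_diff_fderive df); exact: fgn.
move=> [fd fk]; split=> [x Ux|]; first by have [] := gd x Ux (fd x Ux).
by apply: IH fk => y Uy; apply/esym/fderive_is_diff/gd/fd.
Unshelve. all: end_near. Qed.

(** [Ck_on] unfolds to conditions at single points, so each point may bring its own set [U']. *)
Lemma Ck_on_local (U : set V) k (W : normedModType R) (f : V -> W) :
  (forall x, U x -> exists2 U' : set V, U' x & Ck_on U' k f) -> Ck_on U k f.
Proof.
elim: k W f => [|k IH] W f /= fU.
  by move=> x /fU[U' U'x]; apply.
split=> [x /fU[U' U'x [fd _]]|]; first exact: fd.
by apply: IH => x /fU[U' U'x [_ fk]]; exists U'.
Qed.

End CkOn.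

Section Tensor.
Context {R : realType} {V W : normedModType R}.

Lemma clin_tensor_subproof (l : clin V R^o) (w : W) :
  (fun v => l v *: w) \in @clin_pred R V W.
Proof.
apply/asboolP; split=> [a u v|x]; first by rewrite clin_linear scalerDl scalerA.
by apply: cvgZr_tmp; exact: clin_continuous.
Qed.

(** The rank-one operator $l \otimes w$; with [l] the differential of [u], it is that of
    [u y *: w]. *)
Definition clin_tensor l w : clin V W := CLin (clin_tensor_subproof l w).

Lemma clin_tensorDl l m w :
  clin_tensor (l + m) w = clin_tensor l w + clin_tensor m w.
Proof. by apply/val_inj/funext => v; rewrite /= scalerDl. Qed.

Lemma clin_tensorZl (a : R) l w : clin_tensor (a *: l) w = a *: clin_tensor l w.
Proof. by apply/val_inj/funext => v; rewrite /= [RHS]scalerA. Qed.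

Lemma clin_tensor0l w : clin_tensor 0 w = 0.
Proof. by apply/val_inj/funext => v; rewrite /= scale0r. Qed.

End Tensor.

(** * Vector-valued combinations with coefficients in a class of functions *)

Section Combinations.
Context {R : realType} {V : normedModType R}.
Variables (U : set V) (A : (V -> R) -> Prop).

(** The target [W] has to vary: successive derivatives take values in [clin V W],
    [clin V (clin V W)], and so on. *)
Inductive comb (W : normedModType R) : (V -> W) -> Prop :=
| comb0 : comb (fun=> 0)
| combS u w f : A u -> comb f -> comb (fun y => u y *: w + f y).

Lemma combD (W : normedModType R) (f g : V -> W) :
  comb f -> comb g -> comb (fun y => f y + g y).
Proof.
move=> + cg; elim=> [|u w {}f Au _ IH].
  by rewrite (_ : (fun _ => _) = g)//; apply/funext => y; rewrite add0r.
rewrite (_ : (fun _ => _) = (fun y => u y *: w + (f y + g y))).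
  exact: combS.
by apply/funext => y; rewrite addrA.
Qed.

Lemma comb_tensor (W : normedModType R) (D : V -> clin V R^o) (w : W) :
  comb D -> comb (fun y => clin_tensor (D y) w).
Proof.
elim=> [|u l f Au _ IH].
  rewrite (_ : (fun _ => _) = (fun=> 0)); first exact: comb0.
  by apply/funext => y; rewrite clin_tensor0l.
rewrite (_ : (fun _ => _) =
  (fun y => u y *: clin_tensor l w + clin_tensor (f y) w)).
  exact: combS.
by apply/funext => y; rewrite clin_tensorDl clin_tensorZl.
Qed.

Definition comb_differentiable (W : normedModType R) (f : V -> W) :=
  exists2 D : V -> clin V W, comb D & forall y, U y -> is_diff y f (D y).

Hypothesis A_diff : forall u : V -> R, A u -> comb_differentiable (u : V ->
  R^o).

Lemma comb_is_diff (W : normedModType R) (f : V -> W) :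
  comb f -> comb_differentiable f.
Proof.
elim=> [|u w {}f /A_diff[Du cDu du] _ [Df cDf df]].
  by exists (fun=> 0) => [|y _]; [exact: comb0|exact: is_diff_cst].
exists (fun y => clin_tensor (Du y) w + Df y).
  by apply: combD => //; exact: comb_tensor.
move=> y Uy; have duy := du y Uy; have dfy := df y Uy.
have dw : is_diff y (fun y => u y *: w) (clin_tensor (Du y) w).
  split; first by apply: differentiableZl; case: duy.
  by rewrite diffZl; case: duy => // _ ->.
exact: is_diffD.
Qed.

(** Induction on [k] over all targets at once: the derivative of a combination is a combination with
    target [clin V W]. *)
Lemma comb_Ck (W : normedModType R) (f : V -> W) k :
  open U -> comb f -> Ck_on U k f.
Proof.
move=> oU; elim: k W f => [|k IH] W f cf.
  move=> x Ux; have [D _ /(_ x Ux)[+ _]] := comb_is_diff cf.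
  exact: differentiable_continuous.
have [D cD fD] := comb_is_diff cf; split=> [x Ux|]; first by case: (fD x Ux).
apply: (@Ck_on_eq _ _ _ _ _ D) => //; last exact: IH.
by move=> y Uy; apply/esym/fderive_is_diff/fD.
Qed.

End Combinations.

(** * A flat convex function *)

Section Flat.
Context {R : realType}.
Implicit Types (n : nat) (t : R).

(** For $t > 0$ this is $t^{1-n} e^{-1/t}$. The index [n] makes the linear span of the family closed
    under differentiation, [dflat n] being the derivative of [flat n]. *)
Definition flat n t : R := if 0 < t then t * t^-1 ^+ n * expR (- t^-1) else 0.
Definition dflat n t : R := (1 - n%:R) * flat n.+1 t + flat n.+2 t.

Lemma flat_le0 n t : t <= 0 -> flat n t = 0.
Proof. by rewrite /flat leNgt => /negbTE ->. Qed.

Lemma flat_gt0 n t : 0 < t -> 0 < flat n t.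
Proof.
by move=> t0; rewrite /flat t0 !mulr_gt0 ?exprn_gt0 ?invr_gt0 ?expR_gt0.
Qed.

Lemma flat_ge0 n t : 0 <= flat n t.
Proof. by have [/flat_le0->//|/flat_gt0/ltW] := leP t 0. Qed.

(** This is $e^u \ge u^{n+1}/(n+1)!$ at $u = 1/t$. The quadratic rate yields the derivative $0$ at
    the origin. *)
Lemma flat_le_sqr n t : 0 < t -> flat n t <= n.+1`!%:R * t ^+ 2.
Proof.
move=> t0; rewrite /flat t0.
have u0 : 0 < t^-1 by rewrite invr_gt0.
have f0 : 0 < n.+1`!%:R :> R by rewrite ltr0n fact_gt0.
have : t^-1 ^+ n.+1 <= n.+1`!%:R * expR t^-1.
  rewrite mulrC -ler_pdivrMr//; apply: le_trans (expR_ge1Dxn n (ltW u0)).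
  by rewrite lerDr.
rewrite exprS expRN => H.
have -> : t * t^-1 ^+ n / expR t^-1 = t ^+ 2 * (t^-1 * t^-1 ^+ n / expR t^-1).
  by field; rewrite ?gt_eqF ?expR_gt0.
by rewrite mulrC ler_wpM2r ?sqr_ge0// ler_pdivrMr ?expR_gt0.
Qed.

Lemma is_derive_flat n t : is_derive t (1 : R) (flat n) (dflat n t).
Proof.
have [t0|t0|->] := ltgtP t 0.
- rewrite /dflat !flat_le0 ?ltW// mulr0 addr0.
  apply: (@near_eq_is_derive _ _ _ (cst 0)).
  by near=> s; rewrite flat_le0// ltW//; near: s; exact: lt_nbhsl.
- apply: (@near_eq_is_derive _ R R (fun s : R =>
    s * s^-1 ^+ n * expR (- s^-1))).
    near=> s; rewrite /flat ifT//; near: s; exact: lt_nbhsr.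
  have tn0 : t != 0 by rewrite gt_eqF.
  have dV : is_derive t (1:R) (fun s : R => s^-1) (- t ^- 2).
    by apply: is_derive_eq; [apply: is_deriveV => //;
      exact: is_derive_id|rewrite scaler1].
  have dE : is_derive t (1:R) (fun s : R =>
    expR (- s^-1)) (expR (- t^-1) * t ^- 2).
    have := @is_derive1_comp _ expR (fun s : R => - s^-1) t _ _
      (is_derive_expR _) (is_deriveN dV).
    by rewrite opprK.
  have dX : is_derive t (1:R) (fun s : R =>
    s^-1 ^+ n) (n%:R * t^-1 ^+ n.-1 * - t ^- 2).
    rewrite (_ : (fun _ => _) = (fun s : R => s^-1) ^+ n);
      first exact: is_deriveX.
    by apply/funext => s; rewrite fctE.
  have dM := @is_deriveM _ _ _ _ _ _ _ _ (is_deriveM (is_derive_id t (1:R)) dX)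
    dE.
  rewrite (_ : (fun _ => _) =
    id * (fun s : R => s^-1 ^+ n) * (fun s : R => expR (- s^-1)))//.
  apply: (is_derive_eq dM).
  rewrite /dflat /flat t0 !fctE /GRing.scale /=.
  case: n {dX dM} => [|n] /=; first by rewrite !exprS !expr0; field.
  by rewrite !exprS -natr1; field.
- have dd : is_diff (0 : R) (flat n : R -> R) (0 : clin R^o R^o).
    apply/is_diff_clinP => eps eps0.
    have f0 : 0 < n.+1`!%:R :> R by rewrite ltr0n fact_gt0.
    near=> s; rewrite (flat_le0 _ (lexx 0)) (_ : (0 : clin R^o R^o) _ = 0)//
      !subr0.
    have [s0|s0] := leP s 0; first by rewrite flat_le0// normr0 mulr_ge0// ltW.
    rewrite (ger0_norm (flat_ge0 _ _)) gtr0_norm//.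
    apply: le_trans (flat_le_sqr _ s0) _; rewrite expr2 mulrA ler_wpM2r ?(ltW
      s0)//.
    rewrite mulrC -ler_pdivlMr//; apply/ltW; near: s; apply: lt_nbhsl.
    by rewrite divr_gt0.
  rewrite /dflat !flat_le0// mulr0 addr0.
  case: dd => df d0; split; first exact/derivable1_diffP.
  by rewrite deriveE// d0.
Unshelve. all: end_near. Qed.

Lemma is_diff_flat n t : is_diff t (flat n : R -> R) (fun h => h * dflat n t).
Proof.
have [df dE] := is_derive_flat n t.
have dff : differentiable (flat n) t by exact/derivable1_diffP.
by split=> //; rewrite diff1E// derive1E dE.
Qed.

End Flat.

Section FlatConvex.
Context {R : realType}.
Implicit Types s t a b : R.

Lemma flat0E t : 0 < t -> flat 0 t = t * expR (- t^-1).
Proof. by move=> t0; rewrite /flat t0 expr0 mulr1. Qed.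

Lemma flat0_homo s t : s <= t -> flat 0 s <= flat 0 t.
Proof.
move=> st; have [s0|s0] := leP s 0; first by rewrite (flat_le0 _ s0) flat_ge0.
have t0 := lt_le_trans s0 st.
by rewrite !flat0E// ler_pM ?expR_ge0 ?(ltW s0)// ler_expR lerN2 lef_pV2.
Qed.

(** The left side is the tangent line of [flat 0] at [a]. For $t > 0$ the bound is $e^{1/a - 1/t}
    \ge 1 + 1/a - 1/t$ multiplied by $t e^{-1/a}$. *)
Lemma flat0_tangent a t :
  0 < a -> expR (- a^-1) * (t * (1 + a^-1) - 1) <= flat 0 t.
Proof.
move=> a0; have [t0|t0] := leP t 0.
  rewrite flat_le0// mulr_ge0_le0 ?expR_ge0//.
  have : t * (1 + a^-1) <= 0.
    by rewrite mulr_le0_ge0// addr_ge0// invr_ge0 ltW.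
  lra.
rewrite flat0E// (_ : - t^-1 = - a^-1 + (a^-1 - t^-1)); last by rewrite addKr.
rewrite expRD mulrCA ler_wpM2l ?expR_ge0//.
rewrite (_ : _ - 1 = t * (1 + (a^-1 - t^-1))).
  by rewrite ler_wpM2l ?expR_ge1Dx// ltW.
by field; rewrite !gt_eqF.
Qed.

(** Where the convex combination [c] is positive, average the tangent bounds at [c]; elsewhere the
    left side vanishes. *)
Lemma flat0_convex l m a b : 0 <= l -> 0 <= m -> l + m = 1 ->
  flat 0 (l * a + m * b) <= l * flat 0 a + m * flat 0 b.
Proof.
move=> l0 m0 lm; have [h|h] := leP (l * a + m * b) 0.
  by rewrite (flat_le0 _ h) addr_ge0// mulr_ge0// flat_ge0.
set c := l * a + m * b in h *.
have := lerD (ler_wpM2l l0 (flat0_tangent a h)) (ler_wpM2l m0 (flat0_tangent b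
  h)).
apply: le_trans; rewrite flat0E// le_eqVlt; apply/orP; left; apply/eqP.
set E := expR _.
transitivity (E * (c * (1 + c^-1) - (l + m))); last by rewrite /c; ring.
have -> : c * (1 + c^-1) - (l + m) = c by rewrite lm; field; rewrite gt_eqF.
by rewrite mulrC.
Qed.

Lemma dflat0_gt0 t : 0 < t -> 0 < dflat 0 t.
Proof. by move=> t0; rewrite /dflat subr0 mul1r addr_gt0// flat_gt0. Qed.

Lemma dflat_le0 n t : t <= 0 -> dflat n t = 0.
Proof. by move=> t0; rewrite /dflat !flat_le0// mulr0 addr0. Qed.

Lemma flat_continuous n : continuous (flat n : R -> R).
Proof.
move=> t; have [df _] := is_diff_flat n t.
exact: differentiable_continuous.
Qed.

End FlatConvex.

(** * A function algebra closed under differentiation *)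

Section SmoothAlgebra.
Context {R : realType} {V : normedModType R}.
Variables (U : set V) (N : V -> R).

(** [N] is itself a generator, so that an implicit formula for its derivative can be written inside
    the algebra. *)
Inductive smooth_alg : (V -> R) -> Prop :=
| smooth_alg_cst c : smooth_alg (fun=> c)
| smooth_alg_lin (l : clin V R^o) : smooth_alg (l : V -> R^o)
| smooth_alg_base : smooth_alg N
| smooth_algD u v : smooth_alg u -> smooth_alg v ->
    smooth_alg (fun y => u y + v y)
| smooth_algM u v : smooth_alg u -> smooth_alg v ->
    smooth_alg (fun y => u y * v y)
| smooth_algV u : smooth_alg u -> (forall y, U y -> u y != 0) ->
    smooth_alg (fun y => (u y)^-1)
| smooth_alg_flat n u : smooth_alg u -> smooth_alg (fun y => flat n (u y)).

Lemma smooth_alg_sum (I : Type) (s : seq I) (u : I -> V -> R) :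
  (forall i, smooth_alg (u i)) -> smooth_alg (fun y => \sum_(i <- s) u i y).
Proof.
move=> su; elim: s => [|i s IH].
  rewrite (_ : (fun _ => _) = (fun=> 0)); first exact: smooth_alg_cst.
  by apply/funext => y; rewrite big_nil.
rewrite (_ : (fun _ => _) = (fun y => u i y + \sum_(i <- s) u i y)).
  exact: smooth_algD.
by apply/funext => y; rewrite big_cons.
Qed.

Lemma combZ (W : normedModType R) (v : V -> R) (f : V -> W) :
  smooth_alg v -> comb smooth_alg f -> comb smooth_alg (fun y => v y *: f y).
Proof.
move=> sv; elim=> [|u w {}f su _ IH].
  rewrite (_ : (fun _ => _) = (fun=> 0)); first exact: comb0.
  by apply/funext => y; rewrite scaler0.
rewrite (_ : (fun _ => _) = (fun y => (v y * u y) *: w + v y *: f y)).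
  by apply: combS => //; exact: smooth_algM.
by apply/funext => y; rewrite scalerDr scalerA.
Qed.

Hypothesis N_diff : comb_differentiable U smooth_alg (N : V -> R^o).

Lemma smooth_alg_diff (u : V -> R) :
  smooth_alg u -> comb_differentiable U smooth_alg (u : V -> R^o).
Proof.
elim=> [c|l||{}u v su [Du cu du] sv [Dv cv dv]|{}u v su [Du cu du] sv [Dv cv dv]
  |{}u su [Du cu du] u0|n {}u su [Du cu du]] //.
- exists (fun=> 0); first exact: comb0.
  by move=> y _; exact: is_diff_cst.
- exists (fun=> 1 *: l + 0).
    by apply: (@combS _ _ _ _ (fun=> 1)); [exact: smooth_alg_cst|exact: comb0].
  move=> y _; rewrite scale1r addr0.
  have lc := @clin_continuous _ _ _ l.
  by split; [exact: linear_differentiable|rewrite diff_lin].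
- exists (fun y => Du y + Dv y); first exact: combD.
  by move=> y Uy; have := du y Uy; have := dv y Uy => dvy duy; exact: is_diffD.
- exists (fun y => u y *: Dv y + v y *: Du y).
    by apply: combD; exact: combZ.
  by move=> y Uy; have := du y Uy; have := dv y Uy => dvy duy; exact: is_diffM.
- exists (fun y => (- 1 * ((u y)^-1 * (u y)^-1)) *: Du y).
    apply: combZ => //; apply: smooth_algM; first exact: smooth_alg_cst.
    by apply: smooth_algM; exact: smooth_algV.
  move=> y Uy; have [duy dE] := du y Uy; have uy0 := u0 y Uy.
  split; first exact: differentiableV.
  by rewrite diffV// dE -expr2 exprVn mulN1r.
- exists (fun y => dflat n (u y) *: Du y).
    apply: combZ => //; apply: smooth_algD; last exact: smooth_alg_flat.
    by apply: smooth_algM; [exact: smooth_alg_cst|exact: smooth_alg_flat].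
  move=> y Uy; have duy := du y Uy; have df := is_diff_flat n (u y).
  have [dc dE] := is_diff_comp duy df; split; first exact: dc.
  by rewrite [LHS]dE; apply/funext => h /=; rewrite mulrC.
Qed.

(** [N_diff] gives one derivative of [N] with coefficients in the algebra. By [smooth_alg_diff]
    these coefficients can be differentiated inside the algebra, which bootstraps [D] to every
    order. *)
Lemma smooth_alg_Ck k : open U -> Ck_on U k (N : V -> R^o).
Proof.
move=> oU; have [D cD ND] := N_diff.
case: k => [|k].
  by move=> x /ND[+ _]; exact: differentiable_continuous.
split=> [x /ND[]//|].
apply: (@Ck_on_eq _ _ _ _ _ D) => //.
  by move=> y Uy; apply/esym/fderive_is_diff/ND.
exact: (comb_Ck smooth_alg_diff).
Qed.

End SmoothAlgebra.

(** * Implicit differentiation *)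

Section Caratheodory.
Context {R : realType}.

(** Caratheodory's form of differentiability: the difference quotient, completed by [df] at [t], is
    continuous there. *)
Lemma is_diff_slope (f : R -> R) (t df : R) : is_diff t f (fun h => h * df) ->
  exists q : R -> R, [/\ {for t, continuous q}, q t = df &
    forall s, f s - f t = q s * (s - t)].
Proof.
move=> fd; exists (fun s => if s == t then df else (f s - f t) / (s - t)).
split; last 2 first.
- by rewrite eqxx.
- move=> s; case: eqVneq => [->|st]; first by rewrite !subrr mulr0.
  by rewrite divfK// subr_eq0.
rewrite /prop_for /continuous_at eqxx; apply/cvgrPdist_le => eps eps0.
have := is_diff_le fd eps0; apply: filterS => s.
case: eqVneq => [_ _|st]; first by rewrite subrr normr0 ltW.
have st0 : s - t != 0 by rewrite subr_eq0.
rewrite -ler_pdivrMr ?normr_gt0// -normf_div distrC.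
by rewrite mulrBl [_ * df]mulrC mulfK.
Qed.

Context {V : normedModType R}.

Lemma clin_sumE (I : Type) (s : seq I) (W : normedModType R)
    (F : I -> clin V W) v :
  (\sum_(i <- s) F i) v = \sum_(i <- s) F i v.
Proof. by elim/big_rec2: _ => // i y1 y2 _ <-. Qed.

Lemma is_diff_caratheodory (I : Type) (s : seq I) (b : I -> V -> R)
    (d : I -> clin V R^o) (f : V -> R^o) x :
  (forall i, {for x, continuous (b i)}) ->
  (\forall y \near x, f y - f x = \sum_(i <- s) b i y * d i (y - x)) ->
  is_diff x f (\sum_(i <- s) b i x *: d i : clin V R^o).
Proof.
move=> bc fE; apply/is_diff_clinP => eps eps0.
have sumc : (\sum_(i <- s) `|b i y - b i x| * opnorm (d i)) @[y --> x] -->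
    \sum_(i <- s) `|b i x - b i x| * opnorm (d i).
  apply: cvg_big => [|i _]; first exact: add_continuous.
  apply: cvgM; last exact: cvg_cst.
  by apply: cvg_norm; apply: cvgB; [exact: bc|exact: cvg_cst].
rewrite big1 in sumc; last by move=> i _; rewrite subrr normr0 mul0r.
move/cvgrPdist_le: sumc => /(_ _ eps0) sumc.
near=> y.
have -> : f y - f x = \sum_(i <- s) b i y * d i (y - x) by near: y.
have : `|0 - \sum_(i <- s) `|b i y - b i x| * opnorm (d i)| <= eps by near: y.
rewrite sub0r normrN => h; apply: le_trans (ler_wpM2r (normr_ge0 _) h).
rewrite clin_sumE -sumrB; apply: le_trans (ler_norm_sum _ _ _) _.
apply: le_trans (ler_wpM2r (normr_ge0 _) (ler_norm _)).
rewrite mulr_suml; apply: ler_sum => i _.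
rewrite [X in _ - X](_ : _ = b i x * d i (y - x))// -mulrBl normrM -mulrA.
by rewrite ler_wpM2l// le_opnorm.
Unshelve. all: end_near. Qed.

End Caratheodory.

Section ImplicitNorm.
Context {R : realType} {V : normedModType R} {I : Type}.
Variables (U : set V) (N : V -> R) (s : seq I) (B : I -> R) (d : I -> clin V
  R^o).
Hypothesis B_ge0 : forall i, 0 <= B i.
Hypothesis N_gt0 : forall y, U y -> 0 < N y.
Hypothesis N_cont : forall y, U y -> {for y, continuous N}.
Hypothesis U_open : open U.
Hypothesis N_eq : forall y, U y ->
  \sum_(i <- s) B i * flat 0 (d i y / N y - 1) = 1.

Let t i y := d i y / N y - 1.
(** The derivative of $\sum_i B_i \psi(d_i(y)/\nu - 1)$ in $\nu$ at $\nu = N(y)$ is $-Q(y)/N(y)^2$,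
    where $\psi$ is [flat 0]. *)
Let Q y := \sum_(i <- s) B i * dflat 0 (t i y) * d i y.

(** [dflat 0] vanishes unless [t i y > 0], and then [d i y > N y > 0], so the terms are nonnegative.
    If all were zero, so would be those of [N_eq], whose sum is 1. *)
Let Q_gt0 y : U y -> 0 < Q y.
Proof.
move=> Uy; have Ny := N_gt0 Uy.
have tpos i : 0 < t i y -> 0 < d i y.
  by move=> h; move: h; rewrite /t subr_gt0 ltr_pdivlMr// mul1r;
    exact: lt_trans.
have Q0 i : 0 <= B i * dflat 0 (t i y) * d i y.
  have [h|h] := leP (t i y) 0; first by rewrite dflat_le0// mulr0 mul0r.
  apply: mulr_ge0; last exact/ltW/tpos.
  by apply: mulr_ge0 => //; exact/ltW/dflat0_gt0.
have Qge0 : 0 <= Q y by apply: sumr_ge0.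
rewrite lt_neqAle Qge0 andbT; apply/negP => /eqP Q00.
suff : \sum_(i <- s) B i * flat 0 (d i y / N y - 1) = 0.
  by rewrite N_eq// => /eqP; rewrite oner_eq0.
move: Q00; rewrite /Q; elim: s => [|i r IH]; first by rewrite !big_nil.
rewrite !big_cons => /esym/eqP.
rewrite paddr_eq0 ?sumr_ge0// => /andP[Qi0 /eqP/esym/IH ->]; rewrite addr0.
have [h|h] := leP (t i y) 0; first by rewrite flat_le0// mulr0.
move: Qi0; rewrite mulf_eq0 [d i y == 0]gt_eqF ?tpos// orbF mulf_eq0.
by rewrite [dflat _ _ == 0]gt_eqF ?dflat0_gt0// orbF => /eqP->; rewrite mul0r.
Qed.

Let D y : clin V R^o :=
  \sum_(i <- s) (N y * (Q y)^-1 * (B i * dflat 0 (t i y))) *: d i.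

(** With Caratheodory slopes of [flat 0], subtracting the constraints at [y] and [x] gives a linear
    equation for [N y - N x]. Continuity of [N] then suffices for differentiability. *)
Let N_is_diff x : U x -> is_diff x (N : V -> R^o) (D x).
Proof.
move=> Ux; have Nx := N_gt0 Ux.
have /choice[q qP] (i : I) : exists q : R -> R,
    [/\ {for t i x, continuous q}, q (t i x) = dflat 0 (t i x) &
     forall u, flat 0 u - flat 0 (t i x) = q u * (u - t i x)].
  exact/is_diff_slope/is_diff_flat.
have tc i : {for x, continuous (t i)}.
  apply: cvgB; last exact: cvg_cst.
  apply: cvgM; first exact: clin_continuous.
  by apply: cvgV; [rewrite gt_eqF|exact: N_cont].
pose a i y := B i * q i (t i y).
have ac i : {for x, continuous (a i)}.
  apply: cvgM; first exact: cvg_cst.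
  by apply: continuous_comp; [exact: tc|case: (qP i)].
have ax i : a i x = B i * dflat 0 (t i x) by rewrite /a; case: (qP i) => _ ->.
(* [P] is [Q] with the derivatives replaced by slopes between [x] and [y], and with each functional
   evaluated at [x]. *)
pose P y := \sum_(i <- s) a i y * d i x.
have Px : P x = Q x by apply: eq_bigr => i _; rewrite ax.
have Pc : {for x, continuous P}.
  apply: cvg_big => [|i _]; first exact: add_continuous.
  by apply: cvgM; [exact: ac|exact: cvg_cst].
have PQ0 : 0 < P x by rewrite Px Q_gt0.
have -> : D x = \sum_(i <- s) (N x * (P x)^-1 * a i x) *: d i.
  by apply: eq_bigr => i _; rewrite Px ax.
apply: (@is_diff_caratheodory _ _ _ s (fun i y => N x * (P y)^-1 * a i y)).
  move=> i; apply: cvgM; last exact: ac.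
  by apply: cvgM; [exact: cvg_cst|apply: cvgV; rewrite ?gt_eqF].
near=> y.
have Uy : U y by near: y; exact: open_nbhs_nbhs.
have Py : 0 < P y by near: y; exact: (cvgr_gt _ Pc).
have Ny := N_gt0 Uy.
have : \sum_(i <- s) a i y * (t i y - t i x) = 0.
  rewrite (eq_bigr (fun i => B i * flat 0 (t i y) - B i * flat 0 (t i x))).
    by rewrite sumrB !N_eq// subrr.
  by move=> i _; case: (qP i) => _ _ qi; rewrite -mulrBr qi mulrA.
(* Separates the change of [t i] caused by [d i (y - x)] from the change caused by [N y - N x]. *)
rewrite (eq_bigr (fun i => (N y)^-1 * (a i y * d i (y - x)) -
  (N y - N x) / (N x * N y) * (a i y * d i x))); last first.
  move=> i _; rewrite /t linearB /=; field.
  by rewrite !gt_eqF.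
rewrite sumrB -!mulr_sumr -/(P y) => /eqP; rewrite subr_eq0 => /eqP E.
rewrite (eq_bigr (fun i => N x * (P y)^-1 * (a i y * d i (y - x)))); last first.
  by move=> i _; rewrite mulrA.
rewrite -mulr_sumr.
have -> : \sum_(i <- s) a i y * d i (y - x) = (N y - N x) / N x * P y.
  rewrite -[LHS](mulVKf (lt0r_neq0 Ny)) E; field.
  by rewrite !gt_eqF.
by field; rewrite !gt_eqF.
Unshelve. all: end_near. Qed.

Lemma implicit_norm_Ck k : Ck_on U k (N : V -> R^o).
Proof.
apply: smooth_alg_Ck U_open; exists D; last exact: N_is_diff.
have st i : smooth_alg U N (t i).
  apply: smooth_algD; last exact: smooth_alg_cst.
  apply: smooth_algM; first exact: smooth_alg_lin.
  by apply: smooth_algV => [|y /N_gt0/gt_eqF ->]; first exact: smooth_alg_base.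
have sd i : smooth_alg U N (fun y => B i * dflat 0 (t i y)).
  apply: smooth_algM; first exact: smooth_alg_cst.
  apply: smooth_algD; last exact: smooth_alg_flat.
  by apply: smooth_algM; [exact: smooth_alg_cst|exact: smooth_alg_flat].
have sQ : smooth_alg U N Q.
  apply: smooth_alg_sum => i.
  by apply: smooth_algM => //; exact: smooth_alg_lin.
have sc i : smooth_alg U N (fun y => N y * (Q y)^-1 * (B i * dflat 0 (t i y))).
  apply: smooth_algM => //; apply: smooth_algM; first exact: smooth_alg_base.
  by apply: smooth_algV => // y /Q_gt0/gt_eqF ->.
rewrite /D; elim: s => [|i r IH].
  rewrite (_ : (fun _ => _) = (fun=> 0)); first exact: comb0.
  by apply/funext => y; rewrite big_nil.
rewrite (_ : (fun _ => _) = (fun y => (N y * (Q y)^-1 * (B i * dflat 0 (t i y)))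
  *: d i
  + \sum_(j <- r) (N y * (Q y)^-1 * (B j * dflat 0 (t j y))) *: d j)).
  exact: combS.
by apply/funext => y; rewrite big_cons.
Qed.

End ImplicitNorm.

(** * The gauge of a locally finite family of functionals *)

Lemma ler_sum_fset (R : numDomainType) (I : choiceType) (A B : {fset I})
    (F : I -> R) :
  (forall i, 0 <= F i) -> (forall i, i \in A -> i \notin B -> F i = 0) ->
  \sum_(i <- A) F i <= \sum_(i <- B) F i.
Proof.
move=> F0 FB; pose G i := if i \in A then F i else 0.
rewrite (eq_big_seq G) => [|i iA]; last by rewrite /G iA.
rewrite (big_fset_incl _ (fsubsetUl A B)) => [|i _ /negbTE iA].
  rewrite (big_fset_incl _ (fsubsetUr A B)) => [|i].
    by apply: ler_sum => i _; rewrite /G; case: ifP.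
  by rewrite inE => /orP[iA /(FB _ iA)|->].
by rewrite /G iA.
Qed.

Section Gauge.
Context {R : realType} {V : normedModType R} {I : choiceType}.
Variables (D : set I) (d : I -> clin V R^o) (B : I -> R) (neg : I -> I).
Variables (c C : R).

Definition flat_sum (G : {fset I}) (y : V) (s : R) : R :=
  \sum_(i <- G) B i * flat 0 (d i y / s - 1).

(** The possibly infinite sum of nonnegative terms at [y / s] is bounded through its finite partial
    sums. *)
Definition gauge_mem (y : V) (s : R) : Prop :=
  forall G : {fset I}, {in G, forall i, D i} -> flat_sum G y s <= 1.

Definition gauge (y : V) : R := inf [set s | 0 < s /\ gauge_mem y s].

Hypothesis B_ge0 : forall i, 0 <= B i.
Hypothesis B_gt1 : forall i, D i -> 1 < B i * flat 0 1.
Hypothesis D_neg : forall i, D i -> D (neg i).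
Hypothesis neg_inj : injective neg.
Hypothesis d_neg : forall i y, d (neg i) y = - d i y.
Hypothesis B_neg : forall i, B (neg i) = B i.
Hypothesis c_gt0 : 0 < c.
Hypothesis C_gt0 : 0 < C.
Hypothesis d_le : forall i y, D i -> d i y <= C * `|y|.
Hypothesis d_norming : forall y, exists2 i, D i & c * `|y| <= d i y.

Lemma flat_sum_homo G y s t :
  0 < s -> s <= t -> flat_sum G y t <= flat_sum G y s.
Proof.
move=> s0 st; apply: ler_sum => i _; apply: ler_wpM2l => //.
have t0 := lt_le_trans s0 st.
have [h|h] := leP (d i y) 0.
  rewrite flat_le0 ?flat_ge0//.
  have : d i y / t <= 0 by rewrite mulr_le0_ge0// invr_ge0 ltW.
  lra.
by apply: flat0_homo; rewrite lerB// ler_wpM2l ?(ltW h)// lef_pV2.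
Qed.

Lemma gauge_mem_homo y s t : 0 < s -> s <= t -> gauge_mem y s -> gauge_mem y t.
Proof.
by move=> s0 st ys G /ys; apply: le_trans; exact: flat_sum_homo.
Qed.

Lemma gauge_mem_large y s : 0 < s -> C * `|y| <= s -> gauge_mem y s.
Proof.
move=> s0 ys G GD; rewrite /flat_sum big_seq big1// => i /GD Di.
rewrite flat_le0 ?mulr0// subr_le0 ler_pdivrMr// mul1r.
exact: le_trans (d_le _ Di) _.
Qed.

Lemma gauge_mem_le1 y s i : D i -> gauge_mem y s ->
  B i * flat 0 (d i y / s - 1) <= 1.
Proof.
move=> Di /(_ [fset i]%fset); rewrite /flat_sum big_seq_fset1; apply.
by move=> j; rewrite inE => /eqP ->.
Qed.

(** For smaller [s], a norming functional would have [d i y / s >= 2], and its single term would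
    exceed 1 by [B_gt1]. *)
Lemma gauge_mem_lower y s : 0 < s -> gauge_mem y s -> c / 2 * `|y| <= s.
Proof.
move=> s0 ys; have [i Di ci] := d_norming y.
have := gauge_mem_le1 Di ys; rewrite leNgt; apply: contraNle => sy.
apply: lt_le_trans (B_gt1 Di) _; apply: ler_wpM2l => //; apply: flat0_homo.
suff : 2 <= d i y / s by lra.
by rewrite ler_pdivlMr//; lra.
Qed.

(** $(y+z)/(s+t)$ is the convex combination of $y/s$ and $z/t$ with coefficients [l] and [m]. *)
Lemma gauge_memD y z s t : 0 < s -> 0 < t ->
  gauge_mem y s -> gauge_mem z t -> gauge_mem (y + z) (s + t).
Proof.
move=> s0 t0 ys zt G GD; have st0 : 0 < s + t by rewrite addr_gt0.
pose l := s / (s + t); pose m := t / (s + t).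
have l0 : 0 <= l by rewrite divr_ge0 ?ltW.
have m0 : 0 <= m by rewrite divr_ge0 ?ltW.
have lm : l + m = 1 by rewrite -mulrDl divff ?gt_eqF.
apply: (@le_trans _ _ (l * flat_sum G y s + m * flat_sum G z t)).
  rewrite !mulr_sumr -big_split /=; apply: ler_sum => i _.
  rewrite mulrCA [m * _]mulrCA -mulrDr; apply: ler_wpM2l => //.
  apply: le_trans (flat0_convex _ _ l0 m0 lm).
  rewrite le_eqVlt; apply/orP; left; apply/eqP; congr (flat _ _).
  rewrite linearD /= /l /m; field.
  by rewrite !gt_eqF.
rewrite -lm lerD// -[leRHS]mulr1 ler_wpM2l//; [exact: ys|exact: zt].
Qed.

Lemma gauge_memZ a y s : 0 < a -> gauge_mem y s -> gauge_mem (a *: y) (a * s).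
Proof.
move=> a0 ys G GD; apply: le_trans (ys G GD); apply: ler_sum => i _.
by rewrite linearZ /= [a *: _](_ : _ = a * d i y)// -mulf_div divff ?gt_eqF//
  mul1r.
Qed.

Lemma gauge_memN y s : gauge_mem y s -> gauge_mem (- y) s.
Proof.
move=> ys G GD; have := ys [fset neg i | i in G]%fset.
rewrite /flat_sum big_imfset /=; last by move=> i j _ _; exact: neg_inj.
move=> /(_ _)/wrap[i /imfsetP[j /= /GD Dj ->]|h]; first exact: D_neg.
apply: le_trans h; apply: ler_sum => i _.
by rewrite B_neg d_neg linearN.
Qed.

Let gauge_has_inf y : has_inf [set s | 0 < s /\ gauge_mem y s].
Proof.
split; last by exists 0 => s [/ltW].
exists (C * `|y| + 1); split; first by rewrite ltr_wpDl// mulr_ge0// ltW.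
apply: gauge_mem_large; last by rewrite lerDl.
by rewrite ltr_wpDl// mulr_ge0// ltW.
Qed.

Lemma gauge_le y s : 0 < s -> gauge_mem y s -> gauge y <= s.
Proof. by move=> s0 ys; apply: ge_inf; [case: (gauge_has_inf y)|]. Qed.

Lemma gauge_lt y t : gauge y < t -> 0 < t /\ gauge_mem y t.
Proof.
move=> /(inf_lt (gauge_has_inf y).1)[s [s0 ys] st].
by split; [exact: lt_trans st|exact: gauge_mem_homo (ltW st) ys].
Qed.

Lemma gauge_lower y : c / 2 * `|y| <= gauge y.
Proof.
apply: lb_le_inf => [|s [s0 ys]]; first by case: (gauge_has_inf y).
exact: gauge_mem_lower.
Qed.

Lemma gauge_upper y : gauge y <= C * `|y|.
Proof.
apply/ler_addgt0Pr => e e0.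
have h : 0 < C * `|y| + e by rewrite ltr_wpDl// mulr_ge0// ltW.
by apply: gauge_le => //; apply: gauge_mem_large => //; rewrite lerDl ltW.
Qed.

Lemma gauge_ge0 y : 0 <= gauge y.
Proof.
by apply: le_trans (gauge_lower y); rewrite mulr_ge0// divr_ge0// ltW.
Qed.

Lemma gauge_gt0 y : y != 0 -> 0 < gauge y.
Proof.
move=> y0; apply: lt_le_trans (gauge_lower y).
by rewrite mulr_gt0 ?divr_gt0 ?normr_gt0.
Qed.

Lemma gaugeD y z : gauge (y + z) <= gauge y + gauge z.
Proof.
apply/ler_addgt0Pr => e e0; have e2 : 0 < e / 2 by rewrite divr_gt0.
have [ys0 ys] : 0 < gauge y + e / 2 /\ gauge_mem y (gauge y + e / 2).
  by apply: gauge_lt; rewrite ltrDl.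
have [zs0 zs] : 0 < gauge z + e / 2 /\ gauge_mem z (gauge z + e / 2).
  by apply: gauge_lt; rewrite ltrDl.
have := gauge_le (addr_gt0 ys0 zs0) (gauge_memD ys0 zs0 ys zs).
by rewrite addrACA -splitr.
Qed.

Let gaugeZ_le a y : 0 < a -> gauge (a *: y) <= a * gauge y.
Proof.
move=> a0; rewrite -ler_pdivrMl//; apply/ler_addgt0Pr => e e0.
have [s0 ys] : 0 < gauge y + e /\ gauge_mem y (gauge y + e).
  by apply: gauge_lt; rewrite ltrDl.
rewrite ler_pdivrMl//; apply: gauge_le; first by rewrite mulr_gt0.
exact: gauge_memZ.
Qed.

Let gaugeZ_gt0 a y : 0 < a -> gauge (a *: y) = a * gauge y.
Proof.
move=> a0; apply/eqP; rewrite eq_le gaugeZ_le//= -ler_pdivlMl//.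
have ai : 0 < a^-1 by rewrite invr_gt0.
by have := gaugeZ_le (a *: y) ai; rewrite scalerA mulVf ?gt_eqF// scale1r.
Qed.

Lemma gaugeN y : gauge (- y) = gauge y.
Proof.
suff gN z : gauge (- z) <= gauge z.
  by apply/eqP; rewrite eq_le gN /= -{1}(opprK y) gN.
apply/ler_addgt0Pr => e e0.
have [s0 zs] : 0 < gauge z + e /\ gauge_mem z (gauge z + e).
  by apply: gauge_lt; rewrite ltrDl.
by apply: gauge_le => //; exact: gauge_memN.
Qed.

Lemma gauge_is_norm : is_norm gauge.
Proof.
have g0 : gauge 0 = 0.
  apply/eqP; rewrite eq_le gauge_ge0 andbT.
  by apply: le_trans (gauge_upper 0) _; rewrite normr0 mulr0.
split=> [|a y|y gy0]; first exact: gaugeD.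
  have [a0|a0|->] := ltgtP a 0.
  - rewrite -gaugeN -scaleNr gaugeZ_gt0 ?oppr_gt0// ltr0_norm//.
  - by rewrite gaugeZ_gt0// gtr0_norm.
  - by rewrite scale0r normr0 mul0r.
by apply/eqP; apply: contraT => /gauge_gt0; rewrite gy0 ltxx.
Qed.

Lemma gauge_equivalent : equivalent_to_norm gauge.
Proof.
exists (c / 2), C; split=> //; first by rewrite divr_gt0.
by move=> y; rewrite gauge_lower gauge_upper.
Qed.

Lemma gauge_continuous : continuous gauge.
Proof.
move=> y; apply/cvgrPdist_le => e e0; near=> z.
apply: (@le_trans _ _ (C * `|y - z|)).
  rewrite ler_norml; apply/andP; split.
    rewrite lerNl opprB lerBlDl; apply: le_trans (_ : gauge y + gauge (z - y) <=
      _).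
      by rewrite -[in leLHS](subrKC y z) gaugeD.
    by rewrite lerD2l -gaugeN opprB gauge_upper.
  rewrite lerBlDl; apply: le_trans (_ : gauge z + gauge (y - z) <= _).
    by rewrite -[in leLHS](subrKC z y) gaugeD.
  by rewrite lerD2l gauge_upper.
rewrite mulrC -ler_pdivlMr//; near: z.
by apply: cvgr_dist_le => //; rewrite divr_gt0.
Unshelve. all: end_near. Qed.

Lemma flat_sum_continuous G y s : s != 0 -> {for s, continuous (flat_sum G y)}.
Proof.
move=> s0; apply: cvg_big => [|i _]; first exact: add_continuous.
apply: cvgM; first exact: cvg_cst.
apply: (@continuous_comp R R R (fun u => d i y / u - 1) (flat 0));
  last exact: flat_continuous.
apply: cvgB; last exact: cvg_cst.
by apply: cvgM; [exact: cvg_cst|exact: cvgV].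
Qed.

(** The infimum is attained: a finite sum above 1 at [gauge y] would stay above 1 slightly to the
    right, where the scale is admissible. *)
Lemma gauge_memP y : y != 0 -> gauge_mem y (gauge y).
Proof.
move=> y0 G GD; rewrite leNgt; apply/negP => h.
have gy0 := gauge_gt0 y0.
have : nbhs (gauge y) [set t | 1 < flat_sum G y t].
  exact: (cvgr_gt _ (@flat_sum_continuous G y _ (lt0r_neq0 gy0))).
move=> /nbhs_ballP[r /= r0 H].
have r2 : 0 < r / 2 by rewrite divr_gt0.
have : gauge_mem y (gauge y + r / 2) by apply: (proj2 (gauge_lt _));
  rewrite ltrDl.
move=> /(_ G GD); apply/negP; rewrite -ltNge; apply: H.
by rewrite -ball_normE /= opprD addNKr normrN gtr0_norm//; lra.
Qed.

(** The margin [k] is uniform outside [G], so a slight decrease of [s] leaves the terms outside [G]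
    equal to zero. *)
Hypothesis locally_finite : forall x, x != 0 -> exists r k (G : {fset I}),
  [/\ 0 < r, 0 < k, {in G, forall i, D i} &
    forall y s i, `|x - y| < r -> 0 < s -> gauge_mem y s -> D i -> i \notin G ->
      d i y <= s * (1 - k)].

(** Near [x] the gauge solves the finite equation indexed by [G]: were the sum below 1, a slightly
    smaller scale would still be admissible. *)
Lemma gauge_smooth : smooth_norm gauge.
Proof.
move=> k; apply: Ck_on_local => x /= x0.
have [r [e [G [r0 e0 GD lf]]]] := locally_finite x0.
pose U : set V := ball x r `&` [set y | y != 0].
exists U; first by split=> //; exact: ballxx.
have U0 y : U y -> y != 0 by case.
apply: (@implicit_norm_Ck _ _ _ U gauge (enum_fset G) B d) => //.
- by move=> y /U0; exact: gauge_gt0.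
- by move=> y _; exact: gauge_continuous.
- apply: openI; first exact: ball_open.
  rewrite (_ : [set y | _] = ~` [set 0]); last by apply/seteqP;
    split=> y /= /eqP.
  by apply: closed_openC; apply: accessible_closed_set1;
    exact: hausdorff_accessible (@norm_hausdorff _ V).
move=> y Uy; have y0 := U0 y Uy; have gy0 := gauge_gt0 y0.
have ym := gauge_memP y0.
have yr : `|x - y| < r by case: Uy => + _; rewrite -ball_normE.
have : flat_sum G y (gauge y) <= 1 by exact: ym.
rewrite -/(flat_sum G y (gauge y)) le_eqVlt => /predU1P[//|h].
have : nbhs (gauge y) [set t | flat_sum G y t < 1].
  exact: (cvgr_lt _ (@flat_sum_continuous G y _ (lt0r_neq0 gy0))).
move=> /nbhs_ballP[q /= q0 H].
(* The three bounds keep, in order, the finite sum below 1, the terms outside [G] at zero, and the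
   new scale positive. *)
pose m := Num.min (q / 2) (Num.min (gauge y * e) (gauge y / 2)).
have m0 : 0 < m by rewrite !lt_min !divr_gt0 ?mulr_gt0.
have mq : m <= q / 2 by rewrite ge_min lexx.
have me : m <= gauge y * e by rewrite !ge_min lexx !orbT.
have mg : m <= gauge y / 2 by rewrite !ge_min lexx !orbT.
suff : gauge y <= gauge y - m by lra.
have s0 : 0 < gauge y - m by lra.
have Hs : flat_sum G y (gauge y - m) < 1.
  by apply: H; rewrite -ball_normE /= opprB addrC subrK gtr0_norm//; lra.
apply: gauge_le => // G' G'D.
apply: le_trans (ltW Hs); apply: ler_sum_fset => [i|i /G'D Di iG].
  by rewrite mulr_ge0// flat_ge0.
rewrite flat_le0 ?mulr0// subr_le0 ler_pdivrMr// mul1r.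
by apply: le_trans (lf _ _ _ yr gy0 ym Di iG) _; lra.
Qed.


End Gauge.

(** * Norming functionals on a grid *)

Section HahnBanach.
Context {R : realType} {V : normedModType R} {T : lmodType R}.

(** The functional lives on the coefficient space [T] and is dominated through [L], so linear
    relations among vectors of [V] do no harm. Its new value is the supremum of [phi a - |L a - v|],
    finite by [cross]. *)
Lemma hahn_banach_step (L : {linear T -> V}) (phi : {linear T -> R^o}) (v : V) :
  (forall a, phi a <= `|L a|) ->
  exists c : R, forall a t, phi a + c * t <= `|L a + t *: v|.
Proof.
move=> phiL.
have cross a b : phi a - `|L a - v| <= `|L b + v| - phi b.
  rewrite lerBlDr addrAC lerBrDr -linearD /=.
  apply: le_trans (phiL _) _; rewrite linearD /=.
  have -> : L a + L b = (L b + v) + (L a - v) by rewrite [RHS]addrACA subrr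
    addr0 addrC.
  exact: ler_normD.
pose S := [set phi a - `|L a - v| | a in [set: T]].
have S0 : S !=set0 by exists (phi 0 - `|L 0 - v|); exists 0.
have Sub b : ubound S (`|L b + v| - phi b) by move=> _ [a _ <-]; exact: cross.
have Ssup : has_sup S by split => //; exists (`|L 0 + v| - phi 0).
have lec a : phi a - `|L a - v| <= sup S.
  by apply: ub_le_sup; [case: Ssup|exists a].
have cle b : sup S <= `|L b + v| - phi b by apply: ge_sup.
exists (sup S) => a t.
have [t0|t0|->] := ltgtP t 0; last by rewrite mulr0 scale0r !addr0.
- pose u := - t; have u0 : 0 < u by rewrite oppr_gt0.
  have -> : `|L a + t *: v| = u * `|L (u^-1 *: a) - v|.
    rewrite -[X in X * _](gtr0_norm u0) -normrZ linearZ /= scalerBr scalerA.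
    by rewrite divff ?gt_eqF// scale1r scaleNr opprK.
  have -> : phi a = u * phi (u^-1 *: a).
    by rewrite linearZ /= [_ *: _](_ : _ = u^-1 * phi a)// mulVKf ?gt_eqF.
  have := ler_wpM2l (ltW u0) (lec (u^-1 *: a)).
  by rewrite /u; lra.
- have -> : `|L a + t *: v| = t * `|L (t^-1 *: a) + v|.
    rewrite -[X in X * _](gtr0_norm t0) -normrZ linearZ /= scalerDr scalerA.
    by rewrite divff ?gt_eqF// scale1r.
  have -> : phi a = t * phi (t^-1 *: a).
    by rewrite linearZ /= [_ *: _](_ : _ = t^-1 * phi a)// mulVKf ?gt_eqF.
  have := ler_wpM2l (ltW t0) (cle (t^-1 *: a)); lra.
Qed.

End HahnBanach.

Section NormingCoefficients.
Context {R : realType} {V : normedModType R} {Gamma : choiceType}.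
Variables (b : Gamma -> V).

(** [y] has its own coordinate [t], on which the functional is [t * |y|]; the vectors [b g] are
    added one at a time. *)
Lemma hahn_banach_seq (y : V) (s : seq Gamma) : uniq s ->
  exists f : Gamma -> R, forall t (a : Gamma -> R),
    t * `|y| + \sum_(g <- s) f g * a g <= `|t *: y + \sum_(g <- s) a g *: b g|.
Proof.
elim: s => [_|g s IH /= /andP[gs us]].
  exists (fun=> 0) => t a; rewrite !big_nil !addr0 normrZ ler_wpM2r//.
  exact: ler_norm.
have {IH}[f fP] := IH us.
pose L (p : R^o * (Gamma -> R^o)) : V := p.1 *: y + \sum_(h <- s) p.2 h *: b h.
pose phi (p : R^o * (Gamma -> R^o)) : R^o :=
  p.1 * `|y| + \sum_(h <- s) f h * p.2 h.
have linL : linear L.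
  move=> k p q; rewrite /L /= scalerDl -scalerA scalerDr scaler_sumr.
  rewrite [RHS]addrACA -big_split /=; congr (_ + _); apply: eq_bigr => h _.
  by rewrite scalerDl scalerA.
have linphi : linear phi.
  move=> k p q; rewrite [RHS](_ : _ = k * (p.1 * `|y| + \sum_(h <- s) f h * p.2
    h) +
    (q.1 * `|y| + \sum_(h <- s) f h * q.2 h))// /phi /= mulrDr mulr_sumr.
  rewrite [RHS]addrACA -big_split /=; congr (_ + _).
    by rewrite mulrDl mulrA.
  by apply: eq_bigr => h _; rewrite mulrDr mulrCA.
pose Ll : {linear _ -> _} := HB.pack L (GRing.isLinear.Build _ _ _ _ _ linL).
pose phil : {linear _ -> _} := HB.pack phi (GRing.isLinear.Build _ _ _ _ _
  linphi).
have [c cP] := @hahn_banach_step _ _ _ Ll phil (b g) (fun p => fP p.1 p.2).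
exists (fun h => if h == g then c else f h) => t a.
rewrite !big_cons eqxx (eq_big_seq (fun h => f h * a h)) => [|h hs].
  rewrite [c * _ + _]addrC addrA [a g *: _ + _]addrC addrA.
  exact: (cP (t, a) (a g)).
by case: eqP hs gs => // -> ->.
Qed.

Lemma norming_coefficients (A : {fset Gamma}) (a : Gamma -> R) :
  exists f : Gamma -> R,
    (forall x : Gamma -> R,
      \sum_(g <- A) f g * x g <= `|\sum_(g <- A) x g *: b g|) /\
    \sum_(g <- A) f g * a g = `|\sum_(g <- A) a g *: b g|.
Proof.
set y := \sum_(g <- A) a g *: b g.
have [f fP] := hahn_banach_seq y (fset_uniq A).
exists f; split=> [x|].
  by have := fP 0 x; rewrite mul0r add0r scale0r add0r.
apply/eqP; rewrite eq_le; apply/andP; split.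
  by have := fP 0 a; rewrite mul0r add0r scale0r add0r.
(* Here the vector is $y - y = 0$, which forces $\|y\| \le \sum_g f_g a_g$. *)
have := fP 1 (fun g => - a g).
rewrite mul1r scale1r; under [X in _ + X <= _]eq_bigr do rewrite mulrN.
under [X in `|_ + X|]eq_bigr do rewrite scaleNr.
by rewrite !sumrN subrr normr0 subr_le0.
Qed.

End NormingCoefficients.

Lemma finite_fsfun (R : realType) (Gamma : choiceType) (S : {fset Gamma})
    (vals : seq R) :
  finite_set [set g : {fsfun Gamma -> R with 0} |
    (finsupp g `<=` S)%fset /\ forall x, x \in S -> g x \in vals].
Proof.
pose F (h : {ffun S -> 'I_(size vals)}) : {fsfun Gamma -> R with 0} :=
  [fsfun x : S => nth 0 vals (h x)].
apply: (@sub_finite_set _ _ (F @` setT)); last first.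
  by apply: finite_image; exact: finite_finset.
move=> g /= [gS gv].
have idx (x : S) : (index (g (val x)) vals < size vals)%N.
  by rewrite index_mem; apply: gv; exact: valP.
exists [ffun x => Ordinal (idx x)] => //; apply/fsfunP => x.
rewrite /F fsfun_ffun; case: insubP => [u xS ux|xS].
  by rewrite /= ffunE /= nth_index ux// gv.
by rewrite fsfun_dflt//; apply: contra xS => /(fsubsetP gS).
Qed.

(** * Weights decreasing in the size of the support *)

Section Weights.
Context {R : realType}.

Definition weight (n : nat) : R := 1 + n.+1%:R^-1.
(** Half the relative drop between consecutive weights, as in [weightS]. *)
Definition gap (n : nat) : R := (2 * (n.+1%:R * n.+3%:R))^-1.

Lemma weightS n : weight n = weight n.+1 * (1 + 2 * gap n).
Proof.
have n0 : 0 <= n%:R :> R by [].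
by rewrite /weight /gap -!natr1; field; rewrite !gt_eqF//; lra.
Qed.

Lemma weight_homo m n : (m <= n)%N -> weight n <= weight m.
Proof. by move=> mn; rewrite lerD2l lef_pV2 ?posrE ?ltr0n// ler_nat. Qed.

Lemma weight_ge1 n : 1 <= weight n.
Proof. by rewrite lerDl invr_ge0. Qed.

Lemma weight_le2 n : weight n <= 2.
Proof.
rewrite -[leRHS](_ : 1 + 1 = 2); last by lra.
by rewrite lerD2l invf_le1 ?ltr0n// ler1n.
Qed.

Lemma gap_gt0 n : 0 < gap n.
Proof. by rewrite invr_gt0 !mulr_gt0 ?ltr0n. Qed.

Lemma gap_homo m n : (m <= n)%N -> gap n <= gap m.
Proof.
move=> mn; rewrite lef_pV2 ?posrE ?mulr_gt0 ?ltr0n// ler_wpM2l//.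
by rewrite ler_pM ?ler_nat.
Qed.

Lemma gap_le_half n : gap n <= 1 / 2.
Proof.
apply: le_trans (gap_homo (leq0n n)) _.
rewrite /gap mul1r lef_pV2 ?posrE ?mulr_gt0 ?ltr0n// mul1r ler_peMr//.
by rewrite ler1n.
Qed.

(* If p' is almost as large as p while carrying the larger weight of m < n,
   its term alone would push the sum above 1. *)
Lemma weight_drop m n (p p' s e : R) : (m < n)%N -> 0 < s -> 0 < e ->
  e <= gap m -> p - p' <= s * e / 4 ->
  2 / flat 0 (gap m) * flat 0 (weight m * p' / s - 1) <= 1 ->
  weight n * p <= s * (1 - e / 4).
Proof.
move=> mn s0 e0 em pp' h; rewrite leNgt; apply/negP => np.
suff : gap m <= weight m * p' / s - 1.
  move=> /flat0_homo mp; move: h; rewrite mulrAC ler_pdivrMr ?flat_gt0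
    ?gap_gt0//.
  have := flat_gt0 0 (gap_gt0 m); lra.
rewrite lerBrDr ler_pdivlMr//.
have g2 := gap_le_half m; have g0 := gap_gt0 m.
have n0 : 0 < weight n by apply: lt_le_trans (weight_ge1 n).
have m0 : 0 < weight m by apply: lt_le_trans (weight_ge1 m).
have se : 0 < s * (1 - e / 4) by rewrite mulr_gt0//; lra.
have p0 : 0 < p by have := lt_trans se np; rewrite pmulr_rgt0.
(* With $g$ = [gap m], the bounds below give [weight m * p'] $\ge s(1 + 2g - e) \ge s(1 + g)$,
   because $e \le g \le 1/2$. *)
have h1 : weight m * p - weight m * p' <= 2 * (s * e / 4).
  rewrite -mulrBr; apply: le_trans (ler_wpM2l (ltW m0) pp') _.
  by apply: ler_wpM2r (weight_le2 m); rewrite divr_ge0 ?mulr_ge0 ?ltW.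
have h2 : (1 + 2 * gap m) * (s * (1 - e / 4)) <= weight m * p.
  rewrite [weight m]weightS [leRHS]mulrAC [leRHS]mulrC; apply: ler_wpM2l;
    first by lra.
  apply: le_trans (ltW np) _.
  by rewrite ler_wpM2r ?(ltW p0)//; exact: weight_homo.
have h3 : gap m * (e * s) <= 1 / 2 * (e * s).
  by rewrite ler_wpM2r// mulr_ge0 ?ltW.
have h4 : e * s <= gap m * s by rewrite ler_wpM2r// ltW.
lra.
Qed.

End Weights.

(** For $r = u/|v| \ge 1$ with integer part $n$, one has $r < n + 1 \le 2r$. *)
Lemma round_down (R : realType) (u v : R) : v != 0 -> `|v| <= u ->
  exists n : nat, u / n.+1%:R <= `|v| <= 2 * (u / n.+1%:R).
Proof.
move=> v0 vu; have v_gt0 : 0 < `|v| by rewrite normr_gt0.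
have u0 : 0 < u by exact: lt_le_trans vu.
pose r := u / `|v|; have r1 : 1 <= r by rewrite ler_pdivlMr// mul1r.
have r0 : 0 <= r by apply: le_trans r1.
exists (Num.truncn r); have /andP[rl ru] := truncn_itv r0.
set n := Num.truncn r in rl ru *.
have -> : u = r * `|v| by rewrite divfK ?gt_eqF.
have n0 : 0 < n.+1%:R :> R by rewrite ltr0n.
rewrite ler_pdivrMr// mulrA ler_pdivlMr//; apply/andP; split.
  by rewrite mulrC ler_wpM2l// ltW.
rewrite [2 * _]mulrA [leRHS]mulrC ler_wpM2l// -natr1; lra.
Qed.

(** * Grid functionals and their local finiteness *)

Section DualSystem.
Context {R : realType} {V : normedModType R} {Gamma : choiceType}.
Variables (b : Gamma -> V) (coord : Gamma -> clin V R^o).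
Variables (supp : V -> {fset Gamma}) (K : R).
Hypothesis K_gt0 : 0 < K.
Hypothesis coord_out : forall x y, x \notin supp y -> coord x y = 0.
Hypothesis expansion : forall y, y = \sum_(x <- supp y) coord x y *: b x.
Hypothesis proj_le : forall (A : {fset Gamma}) y,
  `|\sum_(x <- A) coord x y *: b x| <= K * `|y|.

Local Notation fsf := {fsfun Gamma -> R with 0}.

Definition pairing (g : fsf) : clin V R^o :=
  \sum_(x <- finsupp g) g x *: coord x.

Lemma pairingE (S : {fset Gamma}) (g : fsf) y : (finsupp g `<=` S)%fset ->
  pairing g y = \sum_(x <- S) g x * coord x y.
Proof.
move=> gS; rewrite /pairing clin_sumE -(big_fset_incl _ gS) => [//|x _ xg].
by rewrite fsfun_dflt// mul0r.
Qed.

(** Absolute values inside the sum make the set stable under restriction and sign change. The grid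
    leaves finitely many values above any positive threshold. *)
Definition dual_set : set fsf := [set g |
  (forall x, x \in finsupp g -> exists n : nat, `|g x| = `|b x| / n.+1%:R) /\
  forall y, \sum_(x <- finsupp g) `|g x * coord x y| <= 2 * K * `|y|].

Lemma dual_le g y : dual_set g -> `|pairing g y| <= 2 * K * `|y|.
Proof.
move=> [_ gK]; rewrite (pairingE _ (fsubset_refl _)).
exact: le_trans (ler_norm_sum _ _ _) (gK y).
Qed.

Definition restrict (T : {fset Gamma}) (g : fsf) : fsf :=
  [fsfun x in [fset x in finsupp g | x \in T]%fset => g x].

Lemma restrictE T g x : restrict T g x = if x \in T then g x else 0.
Proof.
rewrite fsfunE !inE /=; case: (boolP (x \in finsupp g)) => [_ //|xg] /=.
by rewrite fsfun_dflt//; case: ifP.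
Qed.

Lemma finsupp_restrict T g :
  finsupp (restrict T g) = [fset x in finsupp g | x \in T]%fset.
Proof.
apply/fsetP => x; rewrite !mem_finsupp restrictE !inE /= mem_finsupp.
by case: ifP; rewrite ?andbT// ?andbF eqxx.
Qed.

Lemma dual_restrict T g : dual_set g -> dual_set (restrict T g).
Proof.
move=> [gn gK]; split=> [x|y].
  by rewrite finsupp_restrict !inE restrictE => /andP[/= /gn gx ->].
apply: le_trans (gK y); rewrite (eq_big_seq (fun x => `|g x * coord x y|)).
  by apply: ler_sum_fset => // x; rewrite finsupp_restrict !inE => /andP[/= ->].
by move=> x; rewrite finsupp_restrict !inE restrictE => /andP[/= _ ->].
Qed.

Definition oppf (g : fsf) : fsf := [fsfun x in finsupp g => - g x].

Lemma oppfE g x : oppf g x = - g x.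
Proof. by rewrite fsfunE; case: finsuppP => [_|//]; rewrite oppr0. Qed.

Lemma finsupp_oppf g : finsupp (oppf g) = finsupp g.
Proof. by apply/fsetP => x; rewrite !mem_finsupp oppfE oppr_eq0. Qed.

Lemma oppf_inj : injective oppf.
Proof.
move=> g h gh; apply/fsfunP => x; apply: oppr_inj.
by rewrite -!oppfE gh.
Qed.

Lemma dual_oppf g : dual_set g -> dual_set (oppf g).
Proof.
move=> [gn gK]; split=> [x|y]; rewrite finsupp_oppf.
  by move=> /gn[n gx]; exists n; rewrite oppfE normrN.
apply: le_trans (gK y); apply: ler_sum => x _.
by rewrite oppfE mulNr normrN.
Qed.

Lemma pairing_oppf g y : pairing (oppf g) y = - pairing g y.
Proof.
rewrite !(pairingE (S := finsupp g)) ?finsupp_oppf ?fsubset_refl//.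
by rewrite -sumrN; apply: eq_bigr => x _; rewrite oppfE mulNr.
Qed.

(* The values of a Hahn-Banach functional are rounded down to the grid, losing
   at most a factor 2. *)
Lemma dual_norming y : exists2 g, dual_set g & `|y| / 2 <= pairing g y.
Proof.
pose A := supp y.
have [f [fle fy]] := norming_coefficients b A (coord^~ y).
rewrite -expansion in fy.
have restr (P : pred Gamma) (a : Gamma -> R) :
    \sum_(x <- A) f x * (if P x then a x else 0) <=
    `|\sum_(x <- [fset x in A | P x]%fset) a x *: b x|.
  apply: le_trans (fle _) _; rewrite le_eqVlt; apply/orP; left; apply/eqP.
  congr (`|_|); have TA : ([fset x in A | P x] `<=` A)%fset.
    by apply/fsubsetP => x; rewrite !inE => /andP[].
  rewrite -(big_fset_incl _ TA) => [|x xA].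
    by apply: eq_big_seq => x; rewrite !inE => /andP[/= _ ->].
  by rewrite !inE xA /= => /negbTE ->; rewrite scale0r.
have fb x : x \in A -> `|f x| <= `|b x|.
  move=> xA; have := restr (pred1 x) (fun x => Num.sg (f x)).
  have -> : [fset z in A | pred1 x z]%fset = [fset x]%fset.
    by apply/fsetP => z; rewrite !inE /=; case: eqP => [->|];
      rewrite ?xA// andbF.
  rewrite big_seq_fset1 normrZ => h.
  have : `|Num.sg (f x)| * `|b x| <= `|b x|.
    by rewrite normr_sg; case: eqP => _; rewrite ?mul0r ?mul1r.
  apply: le_trans; apply: le_trans h.
  rewrite (big_fsetD1 x)//= eqxx [f x * _]mulrC -normrEsg.
  rewrite big_seq big1 ?addr0// => z; rewrite !inE => /andP[/negbTE-> _].
  by rewrite mulr0.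
(* The constant [2 * K] arises here: coordinates with [f x * coord x z] nonnegative and those with
   it negative give two projections, each of norm at most [K * |z|]. *)
have fK z : \sum_(x <- A) `|f x * coord x z| <= 2 * K * `|z|.
  rewrite (eq_bigr (fun x =>
     f x * (if 0 <= f x * coord x z then coord x z else 0) +
     f x * (if f x * coord x z < 0 then coord x (- z) else 0))); last first.
    move=> x _; rewrite linearN /=; case: leP => h.
      by rewrite mulr0 addr0 ger0_norm.
    by rewrite mulr0 add0r mulrN ltr0_norm.
  rewrite big_split /= -mulrA mulr_natl mulr2n; apply: lerD.
    by apply: le_trans (restr (fun x => 0 <= f x * coord x z) (coord^~ z)) _.
  apply: le_trans (restr (fun x => f x * coord x z < 0) (coord^~ (- z))) _.
  by apply: le_trans (proj_le _ _) _; rewrite normrN.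
have /choice[n nP] x : exists n : nat, x \in A -> f x != 0 ->
    `|b x| / n.+1%:R <= `|f x| <= 2 * (`|b x| / n.+1%:R).
  have [xA|xA] := boolP (x \in A); last by exists 0.
  have [->|fx0] := eqVneq (f x) 0; first by exists 0.
  by have [m mP] := round_down fx0 (fb x xA); exists m.
(* The signs follow [coord x y], so no term of [pairing g y] is negative and each keeps at least
   half of [|f x * coord x y|]. *)
pose g : fsf := [fsfun x in [fset x in A | f x != 0]%fset =>
  Num.sg (coord x y) * (`|b x| / (n x).+1%:R)].
have gE x : x \in A ->
    g x = if f x == 0 then 0 else Num.sg (coord x y) * (`|b x| / (n x).+1%:R).
  by move=> xA; rewrite fsfunE !inE xA /=; case: eqP.
have gA : (finsupp g `<=` A)%fset.
  apply/fsubsetP => x; rewrite mem_finsupp fsfunE !inE /=.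
  by case: (x \in A) => //=; rewrite eqxx.
have q0 x : 0 <= `|b x| / (n x).+1%:R by rewrite divr_ge0.
exists g.
  split=> [x xg|z].
    exists (n x); have := xg; rewrite mem_finsupp gE ?(fsubsetP gA)//.
    case: (eqVneq (f x) 0) => [_|fx0]; first by rewrite eqxx.
    rewrite mulf_eq0 negb_or sgr_eq0 => /andP[y0 _].
    by rewrite normrM normr_sg y0 mul1r ger0_norm.
  apply: le_trans (fK z).
  apply: (@le_trans _ _ (\sum_(x <- A) `|g x * coord x z|)).
    by apply: ler_sum_fset => // x /(fsubsetP gA) ->.
  rewrite big_seq [leRHS]big_seq; apply: ler_sum => x xA.
  rewrite !normrM ler_wpM2r// gE//; case: (eqVneq (f x) 0) => [->//|fx0].
  have /andP[h _] := nP x xA fx0; apply: le_trans h.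
  rewrite normrM normr_sg (ger0_norm (q0 x)).
  by case: eqP; rewrite ?mul0r ?mul1r.
rewrite (pairingE y gA) -fy mulr_suml big_seq [leRHS]big_seq.
apply: ler_sum => x xA; rewrite gE//; case: (eqVneq (f x) 0) => [->|fx0].
  by rewrite !mul0r.
have /andP[_ h] := nP x xA fx0.
rewrite [leRHS]mulrAC -normrEsg ler_pdivrMr//.
apply: le_trans (ler_norm _) _; rewrite normrM.
rewrite -mulrA [leRHS]mulrC; apply: ler_wpM2r => //.
by rewrite mulrC.
Qed.

Definition dual_functional (g : fsf) : clin V R^o :=
  weight #|` finsupp g| *: pairing g.

(** A term whose argument reaches [gap] of the support size is then at least 2, more than the gauge
    constraint allows. *)
Definition dual_weight (g : fsf) : R := 2 / flat 0 (gap #|` finsupp g|).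

Lemma dual_functionalE g y :
  dual_functional g y = weight #|` finsupp g| * pairing g y.
Proof. by []. Qed.

Let weight_gt0 n : 0 < weight n :> R.
Proof. exact: lt_le_trans ltr01 (weight_ge1 n). Qed.

Lemma dual_weight_gt0 g : 0 < dual_weight g.
Proof. by rewrite divr_gt0// flat_gt0// gap_gt0. Qed.

Let dual_weight_gt1 g : 1 < dual_weight g * flat 0 1.
Proof.
have := flat_gt0 0 (@gap_gt0 R #|` finsupp g|) => f0.
rewrite mulrAC ltr_pdivlMr// mul1r.
have : flat 0 (gap #|` finsupp g|) <= flat 0 1 :> R.
  by apply: flat0_homo; apply: le_trans (gap_le_half _) _; lra.
lra.
Qed.

Let dual_functional_le g y : dual_set g -> dual_functional g y <= 4 * K * `|y|.
Proof.
move=> /(dual_le y) gy; rewrite dual_functionalE.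
have := weight_le2 (R := R) #|` finsupp g| => w2.
apply: le_trans (ler_norm _) _; rewrite normrM gtr0_norm//.
apply: le_trans (ler_pM _ _ w2 gy) _ => //; first exact: ltW.
by rewrite !mulrA; lra.
Qed.

Let dual_functional_norming y :
  exists2 g, dual_set g & 2^-1 * `|y| <= dual_functional g y.
Proof.
have [g gD gy] := dual_norming y; exists g => //.
rewrite dual_functionalE mulrC; apply: le_trans (gy) _.
apply: ler_peMl (weight_ge1 _).
by apply: le_trans gy; rewrite divr_ge0.
Qed.

(** [G] collects the dual elements supported in [S] whose nonzero coefficients are at least [tau].
    Any other [g] has a restriction [g'] with strictly smaller support and almost the same value
    near [x], so [weight_drop] applies. *)
Let dual_locally_finite x : x != 0 -> exists r k (G : {fset fsf}),
  [/\ 0 < r, 0 < k, {in G, forall g, dual_set g} &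
    forall y s g, `|x - y| < r -> 0 < s ->
      gauge_mem dual_set dual_functional dual_weight y s ->
      dual_set g -> g \notin G -> dual_functional g y <= s * (1 - k)].
Proof.
move=> x0; pose S := supp x; pose n := #|` S|; pose e : R := gap n.
have e0 : 0 < e := gap_gt0 n.
have nx : 0 < `|x| by rewrite normr_gt0.
(* Any admissible [s] is at least $\|y\|/4$, and $\|y\| \ge \|x\|/2$ near [x]; hence the 8. *)
pose s0 := `|x| / 8; have s0_gt0 : 0 < s0 by rewrite divr_gt0.
pose eta := s0 * e / 4; have eta0 : 0 < eta by rewrite divr_gt0 ?mulr_gt0.
(* [L] bounds $\sum_{z \in S} |coord_z(y)|$ for $\|y\| \le 2\|x\|$; the added 1 makes it positive.
   Half of the loss [eta] pays for small coefficients through [tau], half for coordinates outside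
   [S] through [r]. *)
pose L := \sum_(z <- S) opnorm (coord z) * (2 * `|x|) + 1.
have L0 : 0 < L.
  by rewrite ltr_wpDl// sumr_ge0// => z _;
    rewrite mulr_ge0 ?opnorm_ge0 ?mulr_ge0.
pose tau := eta / 2 / L; have tau0 : 0 < tau by rewrite !divr_gt0.
pose r := Num.min (`|x| / 2) (eta / 2 / (2 * K)).
have r0 : 0 < r by rewrite lt_min !divr_gt0 ?mulr_gt0.
have rx : r <= `|x| / 2 by rewrite ge_min lexx.
have rK : 2 * K * r <= eta / 2.
  by rewrite mulrC -ler_pdivlMr ?mulr_gt0// ge_min lexx orbT.
(* A grid value [|b z| / k.+1] with [z] in [S] that is at least [tau] has [k < M]. *)
pose M := (Num.truncn (\sum_(z <- S) `|b z| / tau)).+1.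
pose grid z :=
  [seq [:: `|b z| / k.+1%:R; - (`|b z| / k.+1%:R)] | k <- iota 0 M].
pose vals : seq R := 0 :: flatten [seq flatten (grid z) | z <- enum_fset S].
pose G0 : set fsf := [set g | [/\ dual_set g, (finsupp g `<=` S)%fset &
  forall z, z \in finsupp g -> tau <= `|g z|]].
have finG0 : finite_set G0.
  apply: sub_finite_set (finite_fsfun S vals) => g [gD gS gtau];
    split=> // z zS.
  rewrite inE; have [zg|] := boolP (z \in finsupp g); last first.
    by move=> /fsfun_dflt ->; rewrite eqxx.
  have [k gz] := gD.1 z zg; have tz := gtau z zg.
  apply/orP; right; apply/flattenP.
  exists (flatten (grid z)); first by apply/mapP; exists z.
  apply/flattenP; exists [:: `|b z| / k.+1%:R; - (`|b z| / k.+1%:R)].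
    apply/mapP; exists k => //; rewrite mem_iota add0n /= ltnS.
    rewrite -[k](@natrK R); apply: le_truncn.
    apply: (@le_trans _ _ (`|b z| / tau)).
      rewrite ler_pdivlMr//; apply: (@le_trans _ _ (k.+1%:R * `|g z|)).
        by rewrite ler_pM ?ler_nat// ltW.
      by rewrite gz mulrC divfK// pnatr_eq0.
    rewrite (big_fsetD1 z)//= lerDl sumr_ge0// => w _.
    by rewrite divr_ge0// ltW.
  rewrite !inE -gz; case: (leP 0 (g z)) => h.
    by rewrite ger0_norm// eqxx.
  by rewrite ltr0_norm// opprK eqxx orbT.
have S0 z : z \notin S -> coord z x = 0 by exact: coord_out.
exists r, (e / 4), (fset_set G0).
have in_G0 g : (g \in fset_set G0) = `[< G0 g >].
  by rewrite in_fset_set// inE.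
split=> //; first by rewrite divr_gt0.
  by move=> g; rewrite in_G0 => /asboolP[].
move=> y s g xy s_gt0 ys gD; rewrite in_G0 => /asboolP gG0.
have ny : `|x| / 2 <= `|y|.
  have := ler_normB x (x - y); rewrite subKr => h.
  have := ler_distD y x 0; rewrite !subr0; lra.
have ny2 : `|y| <= 2 * `|x|.
  have := ler_distD x y 0; rewrite !subr0 distrC; lra.
have ss0 : s0 <= s.
  have := gauge_mem_lower (fun g => ltW (dual_weight_gt0 g))
    (fun g _ => dual_weight_gt1 g) dual_functional_norming s_gt0 ys.
  rewrite /s0; lra.
pose T := [fset z in S | tau <= `|g z|]%fset.
pose g' := restrict T g; have g'D : dual_set g' := dual_restrict T gD.
have g'g : (finsupp g' `<=` finsupp g)%fset.
  by rewrite finsupp_restrict; apply/fsubsetP => z; rewrite !inE => /andP[].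
have g'S : (finsupp g' `<=` S)%fset.
  by rewrite finsupp_restrict; apply/fsubsetP => z; rewrite !inE /= => /and3P[].
have ltc : (#|` finsupp g'| < #|` finsupp g|)%N.
  apply: fproper_ltn_card; rewrite fproperEneq g'g andbT.
  apply/eqP => E; apply: gG0; split=> //; first by rewrite -E.
  by move=> z; rewrite -E finsupp_restrict !inE /= => /and3P[].
have gap_e : e <= gap #|` finsupp g'| by apply: gap_homo;
  exact: fsubset_leq_card.
have close : pairing g y - pairing g' y <= s * e / 4.
  apply: (@le_trans _ _ eta); last first.
    by rewrite /eta ler_wpM2r// ler_wpM2r// ltW.
  rewrite (pairingE y (fsubset_refl _)) (pairingE y g'g) -sumrB.
  (* Outside [S] the coordinate of [x] is zero, so that of [y] equals that of [y - x]. Inside [S],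
     only coefficients below [tau] are lost. *)
  apply: (@le_trans _ _ (\sum_(z <- finsupp g) (`|g z * coord z (y - x)| +
      (if z \in S then tau * `|coord z y| else 0)))).
    apply: ler_sum => z _; rewrite restrictE !inE /=.
    have [zS|zS] /= := boolP (z \in S); last first.
      rewrite mul0r subr0 addr0 linearB /= [coord z x]S0// subr0.
      exact: ler_norm.
    have [h|h] := leP tau `|g z|; first by rewrite subrr addr_ge0// mulr_ge0//
      ltW.
    rewrite mul0r subr0 -[leLHS]add0r; apply: lerD => //.
    by apply: le_trans (ler_norm _) _; rewrite normrM ler_wpM2r// ltW.
  rewrite big_split /=; apply: (@le_trans _ _ (eta / 2 + eta / 2)); last by lra.
  apply: lerD.
    apply: le_trans (gD.2 _) _; apply: le_trans rK; rewrite ler_wpM2l//.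
      by rewrite mulr_ge0 ?ltW.
    by rewrite distrC ltW.
  apply: (@le_trans _ _ (\sum_(z <- S) (if z \in S then tau * `|coord z y| else
    0))).
    apply: ler_sum_fset => [z|z _ /negbTE ->//].
    by case: ifP => // _; rewrite mulr_ge0// ltW.
  rewrite (eq_big_seq (fun z => tau * `|coord z y|)) => [|z ->//].
  rewrite -mulr_sumr /tau mulrAC ler_pdivrMr// ler_wpM2l//;
    first by rewrite divr_ge0// ltW.
  apply: (@le_trans _ _ (\sum_(z <- S) opnorm (coord z) * (2 * `|x|)));
    last first.
    by rewrite /L lerDl.
  apply: ler_sum => z _; apply: le_trans (le_opnorm _ _) _.
  by rewrite ler_wpM2l// opnorm_ge0.
rewrite dual_functionalE; apply: (weight_drop ltc s_gt0 e0 gap_e close).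
by have := gauge_mem_le1 g'D ys.
Qed.

Theorem smooth_norm_of_projections :
  exists N : V -> R, [/\ is_norm N, equivalent_to_norm N & smooth_norm N].
Proof.
exists (gauge dual_set dual_functional dual_weight).
have w0 g := ltW (dual_weight_gt0 g).
have w1 g (_ : dual_set g) := dual_weight_gt1 g.
have dN g y : dual_functional (oppf g) y = - dual_functional g y.
  by rewrite !dual_functionalE pairing_oppf finsupp_oppf mulrN.
have wN g : dual_weight (oppf g) = dual_weight g.
  by rewrite /dual_weight finsupp_oppf.
have K4 : 0 < 4 * K by rewrite mulr_gt0.
have dle g y := @dual_functional_le g y.
split.
- exact: (gauge_is_norm w0 w1 dual_oppf oppf_inj dN wN _ K4 dle
    dual_functional_norming).
- exact: (gauge_equivalent w0 w1 _ K4 dle dual_functional_norming).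
- exact: (gauge_smooth w0 w1 dual_oppf oppf_inj dN wN _ K4 dle
    dual_functional_norming dual_locally_finite).
Qed.

End DualSystem.

(** * Uniform boundedness of the coordinate projections *)

Lemma exists_half_pow (R : realType) (M eps : R) : 0 < eps ->
  exists n : nat, M / 2 ^+ n < eps.
Proof.
move=> eps0; have h : `|2^-1 : R| < 1 by rewrite gtr0_norm ?invr_gt0//
  invf_lt1// ltr1n.
have /cvgrPdist_lt/(_ _ eps0)[n _ /(_ n (leqnn n))] := cvg_geometric M h.
rewrite /= sub0r normrN /geometric /= exprVn => /(le_lt_trans (ler_norm _)) Mn.
by exists n.
Qed.

Section Zabreiko.
Context {R : realType} {X : completeNormedModType R}.
Variable p : X -> R.
Hypothesis pD : forall x y, p (x + y) <= p x + p y.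
Hypothesis pZ : forall a x, p (a *: x) = `|a| * p x.
(* Countable subadditivity, along series with geometrically decaying terms. *)
Hypothesis p_sigma : forall (S : nat -> X) (x : X) (M r : R), 0 <= M ->
  S 0%N = 0 -> (forall n, `|x - S n| <= r / 2 ^+ n) ->
  (forall n, p (S n.+1 - S n) <= M / 2 ^+ n.+1) -> p x <= M.

Let pN x : p (- x) = p x.
Proof. by rewrite -scaleN1r pZ normrN normr1 mul1r. Qed.

Let A n := [set x | p x <= n%:R].

(** The sets [A n] cover [X], so by Baire the closure of one of them has interior. *)
Let ball_sub_closure : exists n (x0 : X) (r : R),
  0 < r /\ ball x0 r `<=` closure (A n).
Proof.
have [n nd] : exists n, ~ dense (~` closure (A n)).
  apply: contrapT => /forallNP nd.
  have : dense (\bigcap_n ~` closure (A n)).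
    apply: Baire => n; split; first by apply: closed_openC;
      exact: closed_closure.
    exact: contrapT (nd n).
  move=> /(_ setT); case; [by exists 0|exact: openT|].
  move=> x [_ /(_ (Num.truncn (p x)).+1 Logic.I)]; apply; apply: subset_closure.
  have := @real_truncnS_gt _ _ (num_real (p x)); exact: ltW.
have [W [[x Wx] WA]] := denseNE nd.
have /nbhs_ballP[r /= r0 xr] := open_nbhs_nbhs Wx.
exists n, x, r; split=> // y /xr Wy; apply: contrapT => nAy.
by have : (W `&` ~` closure (A n)) y by []; rewrite WA.
Qed.

(** Half the difference of approximants to [x0 + x] and [x0 - x] moves the ball to the origin,
    without raising the bound on [p]. *)
Let approx : exists (n : nat) (r : R), 0 < r /\ forall (x : X) (eps : R),
  `|x| < r -> 0 < eps -> exists2 u, p u <= n%:R & `|x - u| < eps.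
Proof.
have [n [x0 [r [r0 rA]]]] := ball_sub_closure.
exists n, r; split=> // x eps xr eps0.
have cl z : `|z| < r -> exists2 u, p u <= n%:R & `|x0 + z - u| < eps.
  move=> zr; have : closure (A n) (x0 + z).
    by apply: rA; rewrite -ball_normE /= opprD addNKr normrN.
  move=> /(_ (ball (x0 + z) eps))[|u [un]]; first exact: nbhsx_ballx.
  by rewrite -ball_normE; exists u.
have [u un xu] := cl x xr; have [|v vn xv] := cl (- x); first by rewrite normrN.
exists (2^-1 *: (u - v)).
  rewrite pZ gtr0_norm ?invr_gt0// ler_pdivrMl//.
  by apply: le_trans (pD _ _) _; rewrite pN; lra.
have -> : x - 2^-1 *: (u - v) = 2^-1 *: ((x0 + x - u) - (x0 + - x - v)).
  rewrite -[x0 + x - u]addrA -[x0 - x - v]addrA opprD addrACA subrr add0r opprD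
    !opprK addrACA -mulr2n -[x *+ 2]scaler_nat.
  by rewrite [RHS]scalerDr scalerA mulVf// scale1r -scalerN opprD opprK.
rewrite normrZ gtr0_norm ?invr_gt0// ltr_pdivrMl//.
by apply: le_lt_trans (ler_normB _ _) _; lra.
Qed.

(** Successive approximation as in the open mapping theorem: residuals below $r/2^k$ are corrected
    by steps with [p] at most $n/2^k$, and [p_sigma] adds these up with $M = 2n$. *)
Theorem zabreiko : exists K, 0 < K /\ forall x, p x <= K * `|x|.
Proof.
have [n [r [r0 rP]]] := approx.
have e2 k : 0 < 2 ^+ k :> R by rewrite exprn_gt0.
have step (k : nat) (x : X) : exists u, `|x| < r / 2 ^+ k ->
    p u <= n%:R / 2 ^+ k /\ `|x - u| < r / 2 ^+ k.+1.
  have [xr|_] := boolP (`|x| < r / 2 ^+ k); last by exists 0.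
  have r2 : 0 < r / 2 by rewrite divr_gt0.
  have [|u un xu] := rP (2 ^+ k *: x) (r / 2) _ r2.
    by rewrite normrZ gtr0_norm// mulrC -ltr_pdivlMr.
  exists ((2 ^+ k)^-1 *: u) => _; split.
    by rewrite pZ gtr0_norm ?invr_gt0// mulrC ler_wpM2r// invr_ge0 ltW.
  have -> : x - (2 ^+ k)^-1 *: u = (2 ^+ k)^-1 *: (2 ^+ k *: x - u).
    by rewrite scalerBr scalerA mulVf ?gt_eqF// scale1r.
  rewrite normrZ gtr0_norm ?invr_gt0// ltr_pdivrMl//.
  suff -> : 2 ^+ k * (r / 2 ^+ k.+1) = r / 2 by [].
  by rewrite exprS; field; rewrite expf_neq0.
have /choice[phi0 phi0P] : forall kx : nat * X, exists u,
  `|kx.2| < r / 2 ^+ kx.1 ->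
    p u <= n%:R / 2 ^+ kx.1 /\ `|kx.2 - u| < r / 2 ^+ kx.1.+1.
  by move=> [k x]; exact: step.
have small x : `|x| < r -> p x <= 2 * n%:R.
  move=> xr; pose S := fix S k := if k is k'.+1 then S k' + phi0 (k',
    x - S k') else 0.
  have xS k : `|x - S k| < r / 2 ^+ k.
    elim: k => [|k IH] /=; first by rewrite subr0 divr1.
    by have [_] := phi0P (k, x - S k) IH; rewrite opprD addrA.
  apply: (p_sigma (S := S) (r := r)) => // [k|k]; first exact: ltW.
  have [+ _] := phi0P (k, x - S k) (xS k).
  by rewrite /= addrAC subrr add0r exprS -mulf_div divff// mul1r.
(* Rescaling to norm $r/2$ gives $4n/r$; the successor keeps the constant positive. *)
have n0 : 0 < 4 * n.+1%:R / r by rewrite divr_gt0// mulr_gt0// ltr0n.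
exists (4 * n.+1%:R / r); split=> // x; have [->|x0] := eqVneq x 0.
  by rewrite normr0 mulr0 -(scale0r 0) pZ normr0 mul0r.
have nx : 0 < `|x| by rewrite normr_gt0.
have := small ((r / 2 / `|x|) *: x).
have rx : 0 < r / 2 / `|x| by rewrite !divr_gt0.
rewrite normrZ pZ (gtr0_norm rx) divfK ?gt_eqF// => /(_ ltac:(lra)).
rewrite -ler_pdivlMl// => /le_trans; apply.
rewrite [leLHS](_ : _ = 4 * n%:R / r * `|x|); last by field; rewrite !gt_eqF.
by rewrite ler_wpM2r// ler_wpM2r ?invr_ge0 ?(ltW r0)// ler_wpM2l// ler_nat.
Qed.

End Zabreiko.

Lemma bounded_clin_pred (R : realType) (V W : normedModType R) (f : V -> W) (C :
  R) :
  0 < C -> (forall a u v, f (a *: u + v) = a *: f u + f v) ->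
  (forall v, `|f v| <= C * `|v|) -> f \in @clin_pred R V W.
Proof.
move=> C0 fl fC; apply/asboolP; split=> // x.
apply/cvgrPdist_le => eps eps0; near=> y.
have -> : f x - f y = f (x - y).
  by rewrite -[y in RHS]scale1r -scaleNr addrC [in RHS]addrC fl scaleNr scale1r.
apply: le_trans (fC _) _; rewrite mulrC -ler_pdivlMr//; near: y.
by apply: cvgr_dist_le => //; rewrite divr_gt0.
Unshelve. all: end_near. Qed.

(** * Coordinates and finite projections of the basis *)

Section UnconditionalBasis.
Context {R : realType} {X : completeNormedModType R} {Gamma : choiceType}.
Variable e : Gamma -> X.
Hypothesis basis_e : unconditional_basis e.

Definition coef (x : X) : Gamma -> R := projT1 (cid (basis_e x)).

Lemma coef_cvg x : summability.partial_sum (fun g => coef x g *: e g)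
  @ summability.totally --> x.
Proof. by rewrite /coef; case: cid => a []. Qed.

Lemma coef_unique x (a : Gamma -> R) :
  summability.partial_sum (fun g => a g *: e g) @ summability.totally --> x ->
  coef x = a.
Proof. by rewrite /coef; case: cid => b /= [_ ab] /ab. Qed.

Lemma coef_near x (eps : R) : 0 < eps -> exists F : {fset Gamma},
  forall G : {fset Gamma}, (F `<=` G)%fset ->
    `|x - \sum_(g <- G) coef x g *: e g| < eps.
Proof. by move: eps; apply/cvg_partial_sumP; exact: coef_cvg. Qed.

Lemma coef_linear (k : R) x y g : coef (k *: x + y) g = k * coef x g + coef y g.
Proof.
have -> // : coef (k *: x + y) = (fun g => k * coef x g + coef y g).
apply: coef_unique.
have -> : summability.partial_sum (fun g => (k * coef x g + coef y g) *: e g) =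
    (fun G => k *: summability.partial_sum (fun g => coef x g *: e g) G +
      summability.partial_sum (fun g => coef y g *: e g) G).
  apply/funext => G; rewrite /summability.partial_sum scaler_sumr -big_split /=.
  by apply: eq_bigr => h _; rewrite scalerDl scalerA.
have tF := @summability.totally_filter Gamma.
have h := cvgD (cvgZl_tmp (k := k) (@coef_cvg x)) (@coef_cvg y). exact: h.
Qed.

Lemma coef_fset (F : {fset Gamma}) (a : Gamma -> R) g :
  coef (\sum_(h <- F) a h *: e h) g = if g \in F then a g else 0.
Proof.
have -> // : coef (\sum_(h <- F) a h *: e h) = (fun g =>
  if g \in F then a g else 0).
apply/coef_unique/cvg_partial_sumP => eps eps0; exists F => G FG.
rewrite -(big_fset_incl _ FG) => [|h _ /negbTE ->]; last by rewrite scale0r.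
rewrite [X in _ - X](eq_big_seq (fun h => a h *: e h)) => [|h ->//].
by rewrite subrr normr0.
Qed.

(** If [e g] were zero, the coefficients 0 and 1 at [g] would both represent the vector 0. *)
Lemma basis_neq0 g : e g != 0.
Proof.
apply/eqP => eg0; have := coef_fset [fset g]%fset (fun=> 1) g.
rewrite inE eqxx big_seq_fset1 scale1r eg0.
have := coef_fset fset0 (fun=> 1) g; rewrite inE big_seq_fset0 => -> /eqP.
by rewrite eq_sym oner_eq0.
Qed.

Definition proj (A : {fset Gamma}) (x : X) : X := \sum_(g <- A) coef x g *: e g.

Lemma projD A x y : proj A (x + y) = proj A x + proj A y.
Proof.
rewrite -big_split; apply: eq_bigr => g _.
by rewrite -[x]scale1r coef_linear mul1r scale1r scalerDl.
Qed.

Lemma projZ A k x : proj A (k *: x) = k *: proj A x.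
Proof.
have c0 g : coef 0 g = 0 by have := coef_fset fset0 (fun=> 0) g;
  rewrite big_seq_fset0.
rewrite scaler_sumr; apply: eq_bigr => g _.
by rewrite -[k *: x]addr0 coef_linear c0 addr0 scalerA.
Qed.

Lemma proj0 A : proj A 0 = 0.
Proof. by have := projZ A 0 0; rewrite !scale0r. Qed.

Lemma projB A x y : proj A (x - y) = proj A x - proj A y.
Proof. by rewrite projD -scaleN1r projZ scaleN1r. Qed.

Let proj_norms x : set R := [set `|proj A x| | A in [set: {fset Gamma}]].

(** Projections onto sets containing a suitable [F] are within 1 of [x]; passing from [A] to the
    union with [F] changes the sum only by terms indexed in [F]. *)
Let proj_has_sup x : has_sup (proj_norms x).
Proof.
split; first by exists `|proj fset0 x|; exists fset0.
have [F FG] := @coef_near x 1 ltr01.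
exists (`|x| + 1 + \sum_(g <- F) `|coef x g *: e g|) => _ [A _ <-].
have := FG (A `|` F)%fset (fsubsetUr _ _).
have -> : \sum_(g <- (A `|` F)%fset) coef x g *: e g =
    proj A x + \sum_(g <- F) (if g \in A then 0 else coef x g *: e g).
  rewrite (big_fset_incl _ (fsubsetUr A F)) => [|g]; last first.
    by rewrite inE => /orP[->|->].
  rewrite /proj [X in _ = X + _](eq_big_seq
    (fun g => if g \in A then coef x g *: e g else 0)) => [|g ->//].
  rewrite [X in _ = X + _](big_fset_incl _ (fsubsetUl A F)) =>
    [|g _ /negbTE ->//].
  rewrite -big_split; apply: eq_bigr => g _ /=.
  by case: ifP; rewrite ?addr0 ?add0r.
set z := \sum_(g <- F) _ => h.
have zF : `|z| <= \sum_(g <- F) `|coef x g *: e g|.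
  apply: le_trans (ler_norm_sum _ _ _) _; apply: ler_sum => g _.
  by case: ifP => // _; rewrite normr0.
have -> : proj A x = x - (x - (proj A x + z)) - z by rewrite subKr addrK.
have := ler_normB (x - (x - (proj A x + z))) z.
have := ler_normB x (x - (proj A x + z)); lra.
Qed.

Let p x := sup (proj_norms x).

Let le_p A x : `|proj A x| <= p x.
Proof. by apply: ub_le_sup; [case: (proj_has_sup x)|exists A]. Qed.

Let p_le x M : (forall A, `|proj A x| <= M) -> p x <= M.
Proof. by move=> xM; apply: ge_sup => [|_ [A _ <-]//];
  case: (proj_has_sup x). Qed.

Let pD x y : p (x + y) <= p x + p y.
Proof.
apply: p_le => A; rewrite projD.
by apply: le_trans (ler_normD _ _) _; rewrite lerD.
Qed.

Let pZ a x : p (a *: x) = `|a| * p x.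
Proof.
have le b y : p (b *: y) <= `|b| * p y.
  by apply: p_le => A; rewrite projZ normrZ ler_wpM2l.
apply/eqP; rewrite eq_le le /=; have [->|a0] := eqVneq a 0.
  by rewrite normr0 mul0r; apply: le_trans (le_p fset0 _).
have na : 0 < `|a| by rewrite normr_gt0.
by rewrite -ler_pdivlMl// -normfV; apply: le_trans (le _ _);
  rewrite scalerA mulVf// scale1r.
Qed.

(** The coefficients of [S n] converge to some [c], with errors of partial sums uniform in the index
    set [A]. So [c] represents [x], uniqueness gives [coef x = c], and the error bound at [n = 0] is
    the claim. *)
Let p_sigma (S : nat -> X) (x : X) (M r : R) : 0 <= M -> S 0%N = 0 ->
  (forall n, `|x - S n| <= r / 2 ^+ n) ->
  (forall n, p (S n.+1 - S n) <= M / 2 ^+ n.+1) -> p x <= M.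
Proof.
move=> M0 S0 xS pS.
have e2 k : 0 < 2 ^+ k :> R by rewrite exprn_gt0.
have pSS n m : (n <= m)%N -> p (S m - S n) <= M / 2 ^+ n.
  move=> /subnKC <-; move: (m - n)%N => {m} k.
  (* The exact geometric partial sum is what the induction on [k] can carry. *)
  suff : p (S (n + k)%N - S n) <= M / 2 ^+ n - M / 2 ^+ (n + k).
    by move=> /le_trans; apply; rewrite gerBl divr_ge0// ltW.
  elim: k => [|k IH].
    by rewrite addn0 !subrr -(scale0r 0) pZ normr0 mul0r.
  rewrite addnS; have -> : S (n + k).+1 - S n = (S (n + k).+1 - S (n + k)%N) +
    (S (n + k)%N - S n).
    by rewrite addrA subrK.
  apply: le_trans (pD _ _) _; apply: le_trans (lerD (pS _) IH) _.
  have -> : M / 2 ^+ (n + k) = 2 * (M / 2 ^+ (n + k).+1).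
    by rewrite exprS; field; rewrite expf_neq0.
  lra.
have coefS n m g : (n <= m)%N -> `|coef (S m) g - coef (S n) g| <= M / 2 ^+ n /
  `|e g|.
  move=> nm; rewrite ler_pdivlMr ?normr_gt0 ?basis_neq0// -normrZ scalerBl.
  apply: le_trans (pSS n m nm); apply: le_trans (le_p [fset g]%fset _).
  by rewrite projB /proj !big_seq_fset1.
have /choice[c cP] g : exists l : R, (coef (S n) g) @[n --> \oo] --> l.
  suff /cauchy_cvg : cauchy (coef (S n) g @[n --> \oo]) by move=> /cvg_ex.
  apply: cauchy_exP => eps eps0; have [n nP] :=
    exists_half_pow (M / `|e g|) eps0.
  exists (coef (S n) g); exists n => // m /= nm; rewrite -ball_normE /= distrC.
  by apply: le_lt_trans (coefS n m g nm) _; rewrite mulrAC.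
have Pc (A : {fset Gamma}) n : `|\sum_(g <- A) c g *: e g - proj A (S n)| <= M /
  2 ^+ n.
  have lim : `|proj A (S m) - proj A (S n)| @[m --> \oo] -->
      `|\sum_(g <- A) c g *: e g - proj A (S n)|.
    apply: cvg_norm; apply: cvgB; last exact: cvg_cst.
    apply: cvg_big => [|g _]; first exact: add_continuous.
    by apply: cvgZr_tmp; exact: cP.
  apply: (cvgr_to_le lim).
  near=> m; rewrite -projB; apply: le_trans (le_p _ _) _; apply: pSS.
  by near: m; exact: nbhs_infty_ge.
have xc : coef x = c.
  apply/coef_unique/cvg_partial_sumP => eps eps0.
  have eps3 : 0 < eps / 3 by rewrite divr_gt0.
  (* The maximum makes one [n] serve both for the tail of [S] and for the uniform error of the
     projections. *)
  have [n nP] := exists_half_pow (Num.max M r) eps3.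
  have Mn : M / 2 ^+ n < eps / 3.
    by apply: le_lt_trans nP; apply: ler_wpM2r;
      rewrite ?le_max ?lexx// invr_ge0 ltW.
  have rn : r / 2 ^+ n < eps / 3.
    by apply: le_lt_trans nP; apply: ler_wpM2r;
      rewrite ?le_max ?lexx ?orbT// invr_ge0 ltW.
  have [F FG] := @coef_near (S n) _ eps3.
  exists F => G /FG; rewrite -/(proj G (S n)) => h.
  have -> : x - \sum_(g <- G) c g *: e g = (x - S n) + (S n - proj G (S n)) -
      (\sum_(g <- G) c g *: e g - proj G (S n)).
    by rewrite opprB !addrA subrK subrK.
  have := Pc G n; have := xS n.
  have := ler_normB (x - S n + (S n - proj G (S n)))
    (\sum_(g <- G) c g *: e g - proj G (S n)).
  have := ler_normD (x - S n) (S n - proj G (S n)); lra.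
apply: p_le => A; have := Pc A 0%N.
by rewrite S0 proj0 subr0 divr1 /proj xc.
Unshelve. all: end_near. Qed.

Lemma proj_bounded : exists K, 0 < K /\
  forall (A : {fset Gamma}) x, `|proj A x| <= K * `|x|.
Proof.
have [K [K0 pK]] := zabreiko pD pZ p_sigma.
by exists K; split=> // A x; apply: le_trans (le_p _ _) (pK x).
Qed.

End UnconditionalBasis.

Theorem theoremB (R : realType) (X : completeNormedModType R)
    (Gamma : choiceType) (e : Gamma -> X) :
  unconditional_basis e ->
  exists N : span_of e -> R,
    [/\ is_norm N, equivalent_to_norm N & smooth_norm N].
Proof.
move=> be; have [K [K0 PK]] := proj_bounded be.
have e_span g : e g \in lspan e.
  by apply/asboolP; exists [fset g]%fset, (fun=> 1);
    rewrite big_seq_fset1 scale1r.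
pose b g : span_of e := SpanOf (e_span g).
have cK x g : `|coef be x g| <= K / `|e g| * `|x|.
  rewrite mulrAC ler_pdivlMr ?normr_gt0 ?(basis_neq0 be)// -normrZ.
  by have := PK [fset g]%fset x; rewrite /proj big_seq_fset1.
have clin_coord g : (fun y : span_of e =>
  coef be (val y) g : R^o) \in @clin_pred R (span_of e) R^o.
  apply: (@bounded_clin_pred _ _ _ _ (K / `|e g|)) => [|a u v|y].
  - by rewrite divr_gt0 ?normr_gt0 ?(basis_neq0 be).
  - exact: coef_linear.
  - exact: cK.
pose coord g : clin (span_of e) R^o := CLin (clin_coord g).
(* The algebraic span enters here: each of its vectors has a finite support. *)
have /choice[supp suppP] : forall y : span_of e, exists F : {fset Gamma},
    (forall g, g \notin F -> coef be (val y) g = 0) /\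
    val y = proj be F (val y).
  move=> [y /= ys]; have /asboolP[F [a ya]] := ys.
  exists F; split=> [g /negbTE gF|]; first by rewrite ya coef_fset gF.
  rewrite [LHS]ya; apply: eq_big_seq => g gF.
  by rewrite ya coef_fset gF.
have val_sum (F : {fset Gamma}) (a : Gamma -> R) :
    val (\sum_(g <- F) a g *: b g) = \sum_(g <- F) a g *: e g.
  by elim/big_rec2: _ => // g x y _ <-.
apply: (@smooth_norm_of_projections _ _ _ b coord supp K K0).
- by move=> g y gy; case: (suppP y) => + _; apply.
- by move=> y; apply: val_inj; rewrite val_sum; case: (suppP y).
- by move=> A y; rewrite !span_normE -[span_val _]/(val _) val_sum; exact: PK.
Qed.
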